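(* Let $R$ be a proper rational fraction of degree $n$ having no poles on the real axis $\mathbb R$. Let $z_1,\dots,z_\nu\in\mathbb C^+$, $n_1,\dots,n_\nu$ (so that $\sum_{k=1}^\nu n_k=n$), and the functions $B_*$ and $\mu_*$ be associated with $R$ as in the context. Let $m\in\mathbb N$, $\varphi\in\mathbb R$ and let the (real) notches $x_k=x_k(m,\varphi)$, $k=1,\dots,mn$, be the roots of the equation $B_*^m(x)=e^{i\varphi}$. Then, if the integrals converge, $$\int_{\mathbb R}R^m(x)\,dx=\frac{\pi}{m}\sum_{k=1}^{mn}\frac{R^m(x_k)}{\mu_*(x_k)},$$ $$\|R\|_{L^{2m}(\mathbb R)}^{2m}:=\int_{\mathbb R}|R(x)|^{2m}\,dx=\frac{\pi}{m}\sum_{k=1}^{mn}\frac{|R(x_k)|^{2m}}{\mu_*(x_k)}.$$ In the case $\varphi\equiv 0\ (\mathrm{mod}\ 2\pi)$ one of the notches is at infinity (the corresponding summand being understood as the limit as $x\to\infty$).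
   Context: A proper rational fraction is a quotient $P/Q$ of polynomials with $\deg P<\deg Q$; its degree is the number of its poles counted with multiplicity. $\mathbb C^+=\{z:\operatorname{Im}z>0\}$. Given a proper rational fraction $R$ of degree $n$ without real poles, put $\mathcal R_*(z)=R(z)\cdot\overline{R(\overline z)}$. Let $z_1,\dots,z_\nu$ be the pairwise distinct poles of $\mathcal R_*$ in $\mathbb C^+$ and $n_k$ their multiplicities, where poles are counted without cancellation against zeros: the $z_k$ are the distinct points of $\mathbb C^+$ such that $z_k$ or $\overline{z_k}$ is a pole of $R$, and $n_k$ is the multiplicity of $z_k$ as a pole of $R$ plus the multiplicity of $\overline{z_k}$ as a pole of $R$ (multiplicity $0$ meaning not a pole). Thus $\sum_{k=1}^\nu n_k=n$. Set $$B_*(x)=\prod_{k=1}^{\nu}\left(\frac{x-z_k}{x-\overline{z_k}}\right)^{n_k},\qquad \mu_*(x)=\sum_{k=1}^{\nu}\frac{n_k\operatorname{Im}z_k}{|x-\overline{z_k}|^2}.$$ For each $m,\varphi$ the equation $B_*^m(x)=e^{i\varphi}$ has exactly $mn$ distinct roots in $\mathbb R\cup\{\infty\}$ (where $B_*(\infty)=1$). *)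

(* Defs.v *)
From HB Require Import structures.
From mathcomp Require Import all_boot all_order all_algebra.
From mathcomp Require Import all_classical all_reals all_analysis.
From mathcomp Require Import complex.

Set Implicit Arguments.
Unset Strict Implicit.
Unset Printing Implicit Defensive.

Import Order.TTheory GRing.Theory Num.Theory.
Import numFieldNormedType.Exports.

Local Open Scope classical_set_scope.
Local Open Scope ring_scope.
Local Open Scope complex_scope.

(* The rational fraction P / Q is studied through its expression in lowest
   terms, so that removable singularities are neither poles nor points where
   the value is the junk 0 / 0 = 0. *)
Definition rf_num (R : realType) (P Q : {poly R[i]}) : {poly R[i]} :=
  P %/ gcdp P Q.

Definition rf_den (R : realType) (P Q : {poly R[i]}) : {poly R[i]} :=
  Q %/ gcdp P Q.

Definition rf_eval (R : realType) (P Q : {poly R[i]}) (w : R[i]) : R[i] :=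
  (rf_num P Q).[w] / (rf_den P Q).[w].

Definition is_pole (R : realType) (P Q : {poly R[i]}) (w : R[i]) : Prop :=
  root (rf_den P Q) w.

Definition pole_mult (R : realType) (P Q : {poly R[i]}) (w : R[i]) : nat :=
  mup w (rf_den P Q).

(* s lists the poles of P / Q, each repeated according to its multiplicity. *)
Definition rf_degree (R : realType) (P Q : {poly R[i]}) (n : nat) : Prop :=
  exists s : seq R[i],
    (forall w, count_mem w s = pole_mult P Q w) /\ size s = n.

(* z enumerates, without repetition, the poles in the upper half-plane of
   w |-> R(w) * conj(R(conj w)) for R = P / Q, and nk gives their
   multiplicities; a pole of one factor is kept even if it is cancelled by a
   zero of the other. *)
Definition star_poles (R : realType) (P Q : {poly R[i]}) (nu : nat)
    (z : 'I_nu -> R[i]) (nk : 'I_nu -> nat) : Prop :=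
  [/\ injective z,
      forall w : R[i], (exists k, z k = w) <->
        0 < complex.Im w /\ (is_pole P Q w \/ is_pole P Q w^*)
    & forall k, nk k = (pole_mult P Q (z k) + pole_mult P Q (z k)^*)%N].

Definition Bstar (R : realType) (nu : nat) (z : 'I_nu -> R[i])
    (nk : 'I_nu -> nat) (x : R) : R[i] :=
  \prod_(k < nu) ((x%:C - z k) / (x%:C - (z k)^*)) ^+ nk k.

Definition mustar (R : realType) (nu : nat) (z : 'I_nu -> R[i])
    (nk : 'I_nu -> nat) (x : R) : R :=
  \sum_(k < nu) (nk k)%:R * complex.Im (z k)
                / ComplexField.Normc.normc (x%:C - (z k)^*) ^+ 2.

(* The line with a point at infinity is the one-point compactification of R,
   whose extra point is None. *)
Definition Bstar_ext (R : realType) (nu : nat) (z : 'I_nu -> R[i])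
    (nk : 'I_nu -> nat) (p : one_point_compactification R) : R[i] :=
  if p is Some x then Bstar z nk x else 1.

Definition expi (R : realType) (phi : R) : R[i] := cos phi +i* sin phi.

Definition notches (R : realType) (nu : nat) (z : 'I_nu -> R[i])
    (nk : 'I_nu -> nat) (m : nat) (phi : R) (N : nat)
    (x : 'I_N -> one_point_compactification R) : Prop :=
  injective x /\
  forall p, (exists k, x k = p) <-> Bstar_ext z nk p ^+ m = expi phi.

(* v is the summand f(p), understood as a limit when p is at infinity. *)
Definition summand (R : realType) (T : topologicalType) (f : R -> T)
    (p : one_point_compactification R) (v : T) : Prop :=
  if p is Some x then v = f x
  else f x @[x --> +oo] --> v /\ f x @[x --> -oo] --> v.

Definition cintegrable (R : realType) (f : R -> R[i]) : Prop :=
  (@lebesgue_measure R).-integrable setT (fun x => (complex.Re (f x))%:E) /\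
  (@lebesgue_measure R).-integrable setT (fun x => (complex.Im (f x))%:E).

Definition cintegral (R : realType) (f : R -> R[i]) : R[i] :=
  (\int[@lebesgue_measure R]_x complex.Re (f x)) +i*
  (\int[@lebesgue_measure R]_x complex.Im (f x)).

(* Main.v *)
Require Import Defs.
From HB Require Import structures.
From mathcomp Require Import all_boot all_order all_algebra.
From mathcomp Require Import all_classical all_reals all_analysis.
From mathcomp Require Import complex.
From mathcomp Require Import measurable_realfun ring lra zify.

Set Implicit Arguments.
Unset Strict Implicit.
Unset Printing Implicit Defensive.

Import Order.TTheory GRing.Theory Num.Theory.
Import numFieldNormedType.Exports.

Local Open Scope classical_set_scope.
Local Open Scope ring_scope.
Local Open Scope complex_scope.

(* Put the poles on one side: with [A] vanishing at the [z_k] and [B] at their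
   conjugates, each with multiplicity [m n_k], the equation is [A = e B], where
   [e = exp (i phi)], and both integrands are [G / (A B)] with
   [deg G <= 2 N - 2], [N = m n] (for [R^m] with [m = 1] by integrability).  Write
   [G / (A B) = a / A + b / B].  Only the leading coefficients of [a] and [b],
   which are opposite, contribute to the integral: it is [2 pi i a_(N-1)].  On
   the other side [K = A' B - A B'] equals [2 i m mu A B] on the real line, so
   the summand is proportional to [G / K]; at a root [y] of [T = A - e B] this is
   [(a + e b)(y) / T'(y)], and the sum over the roots is a Lagrange
   interpolation identity with value [a_(N-1)].  For [e = 1] the degree of [T]
   drops by one and the missing term is the limit of [G / K] at infinity. *)

(** * Sums over the roots of a polynomial *)

Section RootSums.
Variable F : fieldType.
Implicit Types p q a b G T : {poly F}.

Lemma coefM_top p q m n : (size p <= m.+1)%N -> (size q <= n.+1)%N ->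
  (p * q)`_(m + n) = p`_m * q`_n.
Proof.
move=> sp sq; rewrite coefM (bigD1 (inord m)) //= inordK ?ltnS ?leq_addr // addKn.
rewrite big1 ?addr0 // => i; rewrite -val_eqE /= inordK ?ltnS ?leq_addr // => im.
have [lt_im|le_mi] := ltnP i m.
  by rewrite [q`__]nth_default ?mulr0 //; apply: leq_trans sq _; lia.
by rewrite nth_default ?mul0r //; apply: leq_trans sp _; lia.
Qed.

Lemma size_bigprod_XsubC (I : finType) (D : pred I) (y : I -> F) :
  size (\prod_(i | D i) ('X - (y i)%:P)) = #|D|.+1.
Proof.
rewrite size_prod => [|i _]; last by rewrite polyXsubC_eq0.
under eq_bigr do rewrite size_XsubC.
by rewrite sum_nat_const; lia.
Qed.

(** [T] is [T_(n+1)] times the product of the [X - y_i], so [T'(y_i) = T_(n+1) L_i(y_i)], where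
    [L_i] is the product over the other nodes. Expand [p] by Lagrange interpolation and compare
    coefficients of [X^n]. If [T_(n+1) = 0], both sides vanish by the convention [x / 0 = 0]. *)
Lemma lagrange_sum_deriv (I : finType) (D : pred I) (y : I -> F) p T n :
  {in D &, injective y} -> #|D| = n.+1 ->
  (size T <= n.+2)%N -> (forall i, D i -> root T (y i)) -> (size p <= n.+1)%N ->
  \sum_(i | D i) p.[y i] / T^`().[y i] = p`_n / T`_n.+1.
Proof.
move=> injy cardD sT rT sp.
pose L i := \prod_(j | D j && (j != i)) ('X - (y j)%:P).
have cardDi i : D i -> #|[pred j | D j && (j != i)]| = n.
  move=> Di; have := cardD1x Di; rewrite cardD add1n => -[->].
  by apply: eq_card.
have sL i : D i -> size (L i) = n.+1.
  by move=> Di; rewrite /L size_bigprod_XsubC cardDi.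
have lL i : D i -> (L i)`_n = 1.
  move=> Di; have /monicP : L i \is monic by apply: monic_prod_XsubC.
  by rewrite /lead_coef sL.
have Lne i j : D i -> D j -> j != i -> (L i).[y j] = 0.
  move=> Di Dj ji; rewrite horner_prod (bigD1 j) /=; last by rewrite Dj.
  by rewrite hornerXsubC subrr mul0r.
have Ln0 i : D i -> (L i).[y i] != 0.
  move=> Di; rewrite horner_prod; apply/prodf_neq0 => j /andP[Dj ji].
  by rewrite !hornerE subr_eq0; apply: contraNneq ji => /injy -> //.
have uniqv q : (size q <= n.+1)%N -> (forall i, D i -> root q (y i)) -> q = 0.
  move=> sq rq; apply/eqP; apply: contraTT isT => q0.
  have := @max_poly_roots _ q [seq y i | i <- enum D] q0.
  rewrite size_map -cardE cardD ltnNge sq; apply => //.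
    by apply/allP => _ /mapP[i + ->]; rewrite mem_enum; exact: rq.
  rewrite map_inj_in_uniq ?enum_uniq // => i j; rewrite !mem_enum; exact: injy.
pose c := T`_n.+1.
have TE : T = c *: \prod_(i | D i) ('X - (y i)%:P).
  apply/eqP; rewrite -subr_eq0; apply/eqP; apply: uniqv => [|i Di].
    apply/leq_sizeP => j; rewrite leq_eqVlt coefB coefZ => /predU1P[<-|nj].
      have /monicP : \prod_(i | D i) ('X - (y i)%:P) \is monic.
        exact: monic_prod_XsubC.
      by rewrite /lead_coef size_bigprod_XsubC cardD /= => ->; rewrite mulr1 subrr.
    rewrite !nth_default ?mulr0 ?subr0 // ?size_bigprod_XsubC ?cardD //.
    exact: leq_trans nj.
  have /rootP Ti := rT i Di.
  rewrite /root hornerD hornerN hornerZ Ti horner_prod (bigD1 i) //=.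
  by rewrite hornerXsubC subrr mul0r mulr0 subrr.
have dT i : D i -> T^`().[y i] = c * (L i).[y i].
  move=> Di; rewrite TE (bigD1 i) //= derivZ derivM derivXsubC mul1r.
  by rewrite hornerZ hornerD hornerM hornerXsubC subrr mul0r addr0.
have pE : p = \sum_(i | D i) (p.[y i] / (L i).[y i]) *: L i.
  apply/eqP; rewrite -subr_eq0; apply/eqP; apply: uniqv => [|j Dj].
    apply: (leq_trans (size_polyD _ _)); rewrite geq_max sp size_polyN /=.
    apply: (leq_trans (size_sum _ _ _)); apply/bigmax_leqP => i Di.
    by rewrite (leq_trans (size_scale_leq _ _)) ?sL.
  rewrite /root !hornerE horner_sum (bigD1 j) //= hornerZ divfK ?Ln0 //.
  rewrite big1 ?addr0 ?subrr // => i /andP[Di ij].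
  by rewrite hornerZ (Lne i j) ?mulr0 // eq_sym.
rewrite [p in RHS]pE coef_sum mulr_suml; apply: eq_bigr => i Di.
by rewrite coefZ lL // mulr1 dT // -/c invfM mulrA mulrAC.
Qed.

(** From a Bezout relation [u p + v q = 1], take [a] to be [G v] reduced modulo [p] and push the
    quotient into [b]. The bound on [b] then follows from [b p = G - a q]. *)
Lemma coprimep_decomp p q G n : coprimep p q ->
  size p = n.+1 -> size q = n.+1 -> (size G <= n + n)%N ->
  exists a b, [/\ (size a <= n)%N, (size b <= n)%N & G = a * q + b * p].
Proof.
move=> /Bezout_eq1_coprimepP[[u v] /= uv] sp sq sG.
have p0 : p != 0 by rewrite -size_poly_eq0 sp.
pose a := (G * v) %% p; pose d := (G * v) %/ p; pose b := G * u + d * q.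
have GE : G = a * q + b * p.
  have := divp_eq (G * v) p; rewrite -/a -/d /b => Gv.
  by rewrite -[LHS]mulr1 -uv mulrDr !mulrA Gv; ring.
have sa : (size a <= n)%N by rewrite -ltnS -sp ltn_modp.
exists a, b; split => //.
have [->|b0] := eqVneq b 0; first by rewrite size_poly0.
have : (size (b * p)%R <= n + n)%N.
  have -> : b * p = G - a * q by rewrite [in RHS]GE [RHS]addrC addKr.
  rewrite (leq_trans (size_polyD _ _)) // geq_max sG size_polyN /=.
  by rewrite (leq_trans (size_polyMleq _ _)) // sq addnS /= leq_add2r.
by rewrite size_mul // sp addnS /= leq_add2r.
Qed.

(* For [G / (A B) = a / A + b / B] the numbers [G / K] at the roots of
   [T = A - e B] are [(a + e b) / T'], because there [A = e B] and
   [K = B T']. *)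
Lemma sum_roots_neq1 (I : finType) (D : pred I) (y : I -> F) a b A B e k :
  {in D &, injective y} -> #|D| = k.+1 -> e != 1 ->
  A \is monic -> B \is monic -> size A = k.+2 -> size B = k.+2 ->
  (forall i, D i -> A.[y i] = e * B.[y i]) ->
  (forall i, D i -> B.[y i] != 0) ->
  (size a <= k.+1)%N -> (size b <= k.+1)%N -> a`_k + b`_k = 0 ->
  \sum_(i | D i) (a * B + b * A).[y i] / (A^`() * B - A * B^`()).[y i] = a`_k.
Proof.
move=> injy cardD e1 mA mB sA sB AB B0 sa sb ab.
pose T := A - e *: B.
have Tk : T`_k.+1 = 1 - e.
  move: mA mB; rewrite /T coefB coefZ !monicE /lead_coef sA sB /= => /eqP-> /eqP->.
  by rewrite mulr1.
rewrite (eq_bigr (fun i => (a + e *: b).[y i] / T^`().[y i])) => [|i Di]; last first.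
  rewrite /T derivB derivZ !hornerE AB //.
  rewrite [X in X / _](_ : _ = (a.[y i] + e * b.[y i]) * B.[y i]); last by ring.
  rewrite [X in _ / X](_ : _ = (A^`().[y i] - e * B^`().[y i]) * B.[y i]); last by ring.
  by rewrite -mulf_div divff ?mulr1 ?B0.
rewrite (@lagrange_sum_deriv _ _ _ _ T k) //.
(* Since [b_k = - a_k], the top coefficient of [a + e b] is [(1 - e) a_k], and that of [T] is
   [1 - e]. *)
- rewrite Tk coefD coefZ; apply: (@mulIf _ (1 - e)); first by rewrite subr_eq0 eq_sym.
  rewrite divfK ?subr_eq0 1?eq_sym // -[b`_k](addKr a`_k) ab addr0; ring.
- rewrite (leq_trans (size_polyD _ _)) // geq_max sA size_polyN leqnn /=.
  by rewrite (leq_trans (size_scale_leq _ _)) ?sB.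
- by move=> i Di; rewrite /root /T !hornerE AB // subrr.
- rewrite (leq_trans (size_polyD _ _)) // geq_max sa /=.
  by rewrite (leq_trans (size_scale_leq _ _)).
Qed.

(** At [X^(2k)] the product [T' B] contributes [k T_k] and [T B'] contributes [(k + 1) T_k]. *)
Lemma wronskian_top T B k : B \is monic -> size B = k.+2 -> (size T <= k.+1)%N ->
  let K := T^`() * B - T * B^`() in
  (size K <= (k + k).+1)%N /\ K`_(k + k) = - T`_k.
Proof.
move=> mB sB sT K.
have B1 : B`_k.+1 = 1 by move: mB; rewrite monicE /lead_coef sB => /eqP.
have sB' : (size B^`() <= k.+1)%N.
  by rewrite -ltnS -sB lt_size_deriv // -size_poly_eq0 sB.
have sT' : (size T^`() <= k)%N.
  have [->|T0] := eqVneq T 0; first by rewrite derivC size_poly0.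
  by rewrite -ltnS (leq_trans (lt_size_deriv _)).
split.
  rewrite (leq_trans (size_polyD _ _)) // geq_max size_polyN.
  apply/andP; split; apply: leq_trans (size_polyMleq _ _) _.
    by rewrite sB !addnS /= ltnS leq_add2r.
  by rewrite -subn1 leq_subLR (leq_trans (leq_add sT sB')) // addSn addnS.
rewrite coefB [(T * _)`__]coefM_top // coef_deriv B1.
case: k sB sT sT' {sB' K} B1 => [|j] sB sT sT' B1.
  have -> : T^`() = 0 by apply/eqP; rewrite -size_poly_leq0.
  by rewrite mul0r coef0 sub0r mulr1.
rewrite addSnnS coefM_top ?sB // coef_deriv B1 mulr1.
by rewrite [1 *+ _]mulrSr mulrDr mulr1 mulr_natr opprD addrA subrr sub0r.
Qed.

(** Case [e = 1]. With [T = A - B] one has [K = T' B - T B'] and [G = (a + b) B + b T], so at a root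
    of [T] the quotient [G / K] is [(a + b) / T']. For [k > 0] these sum to [(a + b)_(k-1) / T_k],
    and the quotient of the coefficients of [X^(2k)], which is the limit at infinity, is
    [a_k - (a + b)_(k-1) / T_k]. For [k = 0] only the latter is left. *)
Lemma sum_roots_eq1 (I : finType) (D : pred I) (y : I -> F) a b A B k :
  {in D &, injective y} -> #|D| = k -> coprimep A B ->
  A \is monic -> B \is monic -> size A = k.+2 -> size B = k.+2 ->
  (forall i, D i -> A.[y i] = B.[y i]) ->
  (forall i, D i -> B.[y i] != 0) ->
  (size a <= k.+1)%N -> (size b <= k.+1)%N -> a`_k + b`_k = 0 ->
  let G := a * B + b * A in let K := A^`() * B - A * B^`() in
  [/\ (size K <= (k + k).+1)%N, K`_(k + k) != 0 &
  \sum_(i | D i) G.[y i] / K.[y i] + G`_(k + k) / K`_(k + k) = a`_k].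
Proof.
move=> injy cardD cAB mA mB sA sB AB B0 sa sb ab G K.
have A1 : A`_k.+1 = 1 by move: mA; rewrite monicE /lead_coef sA => /eqP.
have B1 : B`_k.+1 = 1 by move: mB; rewrite monicE /lead_coef sB => /eqP.
pose T := A - B.
have sT : (size T <= k.+1)%N.
  apply/leq_sizeP => j; rewrite leq_eqVlt coefB => /predU1P[<-|kj].
    by rewrite A1 B1 subrr.
  by rewrite !nth_default ?subrr ?sA ?sB.
have AE : A = T + B by rewrite subrK.
have KE : K = T^`() * B - T * B^`() by rewrite /K AE derivD; ring.
have [sK Ktop] := wronskian_top mB sB sT; rewrite -KE in sK Ktop.
have rT i : D i -> root T (y i) by move=> Di; rewrite /root !hornerE AB ?subrr.
(* Otherwise [T] has degree below [k] and [k] distinct roots, so [A = B], against coprimality. *)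
have tau0 : T`_k != 0.
  apply/eqP => Tk; have T0 : T = 0.
    have sT' : (size T <= k)%N.
      apply/leq_sizeP => j; rewrite leq_eqVlt => /predU1P[<-//|kj].
      by rewrite nth_default // (leq_trans sT).
    apply/eqP; apply: contraTT isT => T0.
    have := @max_poly_roots _ T [seq y i | i <- enum D] T0.
    rewrite size_map -cardE cardD ltnNge sT'; apply => //.
      by apply/allP => _ /mapP[i + ->]; rewrite mem_enum; exact: rT.
    by rewrite map_inj_in_uniq ?enum_uniq // => i j; rewrite !mem_enum; exact: injy.
  move: cAB; rewrite AE T0 add0r coprimepp sB; by case: (k).
split => //; first by rewrite Ktop oppr_eq0.
have GE : G = (a + b) * B + b * T by rewrite /G AE; ring.
(* The leading terms of [a] and [b] cancel, so [a + b] has degree at most [k - 1], and is zero when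
   [k = 0]; the factor [(0 < k)%:R] covers both cases in one formula. *)
have Gtop : G`_(k + k) = (a + b)`_k.-1 * (0 < k)%:R - a`_k * T`_k.
  have -> : G`_(k + k) = ((a + b) * B)`_(k + k) + b`_k * T`_k.
    by rewrite GE coefD [in X in _ + X]coefM_top.
    have -> : b`_k = - a`_k by apply/eqP; rewrite -addr_eq0 addrC ab.
  rewrite mulNr; congr (_ - _).
  have sab : (size (a + b)%R <= k)%N.
    apply/leq_sizeP => j; rewrite leq_eqVlt coefD => /predU1P[<-//|kj].
    by rewrite !nth_default ?addr0 // ?(leq_trans sa) ?(leq_trans sb).
  case: (k) sab sB B1 => [|j] sab sB' B1'.
    have -> : a + b = 0 by apply/eqP; rewrite -size_poly_leq0.
    by rewrite mul0r !coef0 mul0r.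
  by rewrite addSnnS coefM_top ?sB' // B1'.
rewrite Gtop Ktop.
rewrite (eq_bigr (fun i => (a + b).[y i] / T^`().[y i])) => [|i Di]; last first.
  have Ti := rootP (rT i Di).
  have -> : G.[y i] = (a + b).[y i] * B.[y i].
    by rewrite GE !hornerD !hornerM Ti mulr0 addr0 hornerD.
  have -> : K.[y i] = T^`().[y i] * B.[y i].
    by rewrite KE !hornerD hornerN !hornerM Ti mul0r subr0.
  by rewrite -mulf_div divff ?mulr1 ?B0.
case: (k) cardD sT sa sb ab tau0 => [|j] cardD sT' sa' sb' ab' tau0.
  rewrite big1 => [|i Di]; last by have /= := card0_eq cardD i; rewrite /in_mem /= Di.
  by rewrite ltnn mulr0 !sub0r add0r mulNr invrN mulrN opprK mulfK.
rewrite (@lagrange_sum_deriv _ _ _ _ T j) //=.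
  by rewrite mulr1 invrN mulrN mulrBl mulfK // opprB addrC subrK.
apply/leq_sizeP => i; rewrite leq_eqVlt coefD => /predU1P[<-//|ji].
by rewrite !nth_default ?addr0 // ?(leq_trans sa') ?(leq_trans sb').
Qed.
End RootSums.

(** * Limits of complex-valued functions *)

Section ComplexLimits.
Variable R : realType.
Local Notation C := R[i].
Local Notation Re := (@complex.Re R).
Local Notation Im := (@complex.Im R).

Lemma Re_mul (x y : C) : Re (x * y) = Re x * Re y - Im x * Im y.
Proof. by case: x y => a b [c d]. Qed.

Lemma Im_mul (x y : C) : Im (x * y) = Re x * Im y + Im x * Re y.
Proof. by case: x y => a b [c d]. Qed.

Lemma Re_add (x y : C) : Re (x + y) = Re x + Re y.
Proof. by case: x y => a b [c d]. Qed.

Lemma Im_add (x y : C) : Im (x + y) = Im x + Im y.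
Proof. by case: x y => a b [c d]. Qed.

Lemma Re_opp (x : C) : Re (- x) = - Re x.
Proof. by case: x. Qed.

Lemma Im_opp (x : C) : Im (- x) = - Im x.
Proof. by case: x. Qed.

Lemma Re_inv (x : C) : Re x^-1 = Re x / (Re x ^+ 2 + Im x ^+ 2).
Proof. by case: x. Qed.

Lemma Im_inv (x : C) : Im x^-1 = - Im x / (Re x ^+ 2 + Im x ^+ 2).
Proof. by case: x => a b /=; rewrite mulNr. Qed.

Lemma complex_ext (x y : C) : Re x = Re y -> Im x = Im y -> x = y.
Proof. by case: x y => a b [c d] /= -> ->. Qed.

Lemma normr_complexE (z : C) : `|z| = (ComplexField.Normc.normc z)%:C.
Proof. by []. Qed.

Lemma normr_Im_le (z : C) : `|Im z|%:C <= `|z|.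
Proof.
rewrite normr_complexE lecR; case: z => a b /=.
by rewrite -[X in X <= _]sqrtr_sqr ler_sqrt ?lerDr ?addr_ge0 ?sqr_ge0.
Qed.

Lemma cvg_ext (T : Type) (U : topologicalType) (F : set_system T) (f g : T -> U)
    (l : U) : f x @[x --> F] --> l -> f =1 g -> g x @[x --> F] --> l.
Proof. by move=> h /funext <-. Qed.

Lemma cvg_complex_Re (T : Type) (F : set_system T) {FF : Filter F} (f : T -> C^o)
    (l : C^o) : f x @[x --> F] --> l -> Re (f x) @[x --> F] --> Re l.
Proof.
move=> fl; apply/cvgrPdist_lt => e e0.
have /cvgrPdist_lt /(_ e%:C) := fl; rewrite ltcR => /(_ e0).
apply: filterS => x; rewrite -ltcR; apply: le_lt_trans.
by rewrite -Re_opp -Re_add normc_ge_Re.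
Qed.

Lemma cvg_complex_Im (T : Type) (F : set_system T) {FF : Filter F} (f : T -> C^o)
    (l : C^o) : f x @[x --> F] --> l -> Im (f x) @[x --> F] --> Im l.
Proof.
move=> fl; apply/cvgrPdist_lt => e e0.
have /cvgrPdist_lt /(_ e%:C) := fl; rewrite ltcR => /(_ e0).
apply: filterS => x; rewrite -ltcR; apply: le_lt_trans.
by rewrite -Im_opp -Im_add normr_Im_le.
Qed.

Lemma cvg_realC (T : Type) (F : set_system T) {FF : Filter F} (f : T -> R) (l : R) :
  f x @[x --> F] --> l -> ((f x)%:C : C^o) @[x --> F] --> (l%:C : C^o).
Proof.
move=> fl; apply/cvgrPdist_lt => e e0.
(* The radius is an element of [R[i]]; being positive, it is real. *)
have eE : e = (Re e)%:C.
  by rewrite [LHS]complexE (ger0_Im (ltW e0)) /= mulr0 addr0.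
rewrite eE in e0 *; rewrite ltcR in e0.
have /cvgrPdist_lt /(_ _ e0) := fl.
apply: filterS => x; rewrite -ltcR -rmorphB normr_complexE /=.
by rewrite expr0n /= addr0 sqrtr_sqr.
Qed.

Lemma cvg_complexP (T : Type) (F : set_system T) {FF : Filter F} (f : T -> C^o)
    (l : C^o) : Re (f x) @[x --> F] --> Re l -> Im (f x) @[x --> F] --> Im l ->
  f x @[x --> F] --> l.
Proof.
move=> /cvg_realC fr /cvg_realC fi.
have fi' : ('i%C * (Im (f x))%:C : C^o) @[x --> F] --> ('i%C * (Im l)%:C : C^o).
  exact: cvgM (cvg_cst _) fi.
have -> : f = (fun x => (Re (f x))%:C + 'i%C * (Im (f x))%:C).
  by apply/funext => x; exact: complexE.
by rewrite [l]complexE; exact: cvgD fr fi'.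
Qed.

Lemma cvg_complex_sum (T I : Type) (F : set_system T) {FF : Filter F} (r : seq I)
    (f : I -> T -> C^o) (l : I -> C^o) :
  (forall i, f i x @[x --> F] --> l i) ->
  (\sum_(i <- r) f i x : C^o) @[x --> F] --> (\sum_(i <- r) l i : C^o).
Proof.
move=> fl; elim: r => [|i r IHr].
  by rewrite big_nil; under eq_fun do rewrite big_nil; exact: cvg_cst.
by rewrite big_cons; under eq_fun do rewrite big_cons; exact: cvgD (fl i) IHr.
Qed.

(** After division of [p] and [q] by [u^d], both are polynomials in [1 / u], of which only the
    constant terms survive. The filter and [u] are arbitrary so as to cover both infinities, and
    also [t] and [- t] along the same filter. *)
Lemma cvg_ratio_infty (F : set_system R) {FF : Filter F} (u : R -> R) (p q : {poly C}) d :
  (u x)^-1 @[x --> F] --> 0 -> (\forall x \near F, u x != 0) ->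
  (size p <= d.+1)%N -> (size q <= d.+1)%N -> q`_d != 0 ->
  (p.[(u x)%:C] / q.[(u x)%:C] : C^o) @[x --> F] --> (p`_d / q`_d : C^o).
Proof.
move=> u0 un0 sp sq qd.
have v0 : ((u x)^-1%:C : C^o) @[x --> F] --> (0 : C^o).
  exact: cvg_realC u0.
have vX k : ((u x)^-1%:C ^+ k : C^o) @[x --> F] --> ((k == 0)%:R : C^o).
  case: k => [|k]; first by under eq_fun do rewrite expr0; exact: cvg_cst.
  elim: k => [|k IHk]; first by under eq_fun do rewrite expr1.
  have h := cvgM v0 IHk; rewrite mul0r in h.
  by under eq_fun do rewrite exprS; exact: h.
have lim (r : {poly C}) : (size r <= d.+1)%N ->
    (r.[(u x)%:C] / (u x)%:C ^+ d : C^o) @[x --> F] --> (r`_d : C^o).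
  move=> sr.
  have : (\sum_(i < d.+1) r`_i * (u x)^-1%:C ^+ (d - i) : C^o) @[x --> F] -->
         (\sum_(i < d.+1) r`_i * (d - i == 0)%N%:R : C^o).
    by apply: cvg_complex_sum => i; exact: cvgM (cvg_cst _) (vX _).
  rewrite big_ord_recr /= subnn mulr1 big1 => [|i _]; last first.
    by rewrite subn_eq0 leqNgt ltn_ord mulr0.
  rewrite add0r; apply: cvg_trans; apply: near_eq_cvg.
  near=> x; have ux : (u x)%:C != 0 by rewrite fmorph_eq0; near: x.
  rewrite (horner_coef_wide _ sr) mulr_suml; apply: eq_bigr => i _.
  rewrite -mulrA fmorphV exprVn expfB_cond; last by rewrite (negbTE ux) add0n -ltnS.
  by rewrite invf_div.
have lpq : (p.[(u x)%:C] / (u x)%:C ^+ d / (q.[(u x)%:C] / (u x)%:C ^+ d) : C^o)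
    @[x --> F] --> (p`_d / q`_d : C^o).
  exact: cvgM (lim p sp) (cvgV qd (lim q sq)).
apply: cvg_trans lpq; apply: near_eq_cvg.
near=> x; have ux : (u x)%:C ^+ d != 0 by rewrite expf_neq0 // fmorph_eq0; near: x.
by rewrite invf_div mulrA divfK.
Unshelve. all: by end_near. Qed.
End ComplexLimits.

(** * Principal values of rational functions *)

Section PrincipalValue.
Variable R : realType.
Local Notation C := R[i].
Local Notation Re := (@complex.Re R).
Local Notation Im := (@complex.Im R).

(** Derivative in a real variable, taken on real and imaginary parts, so that the real fundamental
    theorem of calculus and the derivatives of [ln] and [atan] apply directly. *)
Definition cderive (A F : R -> C) := forall t,
  is_derive t (1 : R) (fun u => Re (A u)) (Re (F t)) /\
  is_derive t (1 : R) (fun u => Im (A u)) (Im (F t)).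

(* Principal value of the integral of [F] over the line, in terms of an
   antiderivative [A]: unlike the Lebesgue integral it is linear without
   integrability conditions, so it can be computed on [(t - w)^-1]. *)
Definition pvint (F : R -> C) (v : C) := continuous (F : R -> C^o) /\
  exists A, cderive A F /\ (A t - A (- t) : C^o) @[t --> +oo] --> (v : C^o).

Lemma is_derive_ext (f g : R -> R) x df dg : is_derive x (1 : R) f df ->
  f =1 g -> df = dg -> is_derive x (1 : R) g dg.
Proof. by move=> h /funext <- <-. Qed.

Lemma cderive_ext A B F G : cderive A F -> A =1 B -> F =1 G -> cderive B G.
Proof. by move=> h /funext <- /funext <-. Qed.

Lemma cderiveD A B F G : cderive A F -> cderive B G ->
  cderive (fun t => A t + B t) (fun t => F t + G t).
Proof.
move=> dA dB t; have [a1 a2] := dA t; have [b1 b2] := dB t.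
split.
  apply: (is_derive_ext (is_deriveD a1 b1)) => [u|]; by rewrite ?Re_add.
by apply: (is_derive_ext (is_deriveD a2 b2)) => [u|]; rewrite ?Im_add.
Qed.

Lemma cderiveM A B F G : cderive A F -> cderive B G ->
  cderive (fun t => A t * B t) (fun t => F t * B t + A t * G t).
Proof.
move=> dA dB t; have [a1 a2] := dA t; have [b1 b2] := dB t.
split.
  apply: (is_derive_ext (is_deriveB (is_deriveM a1 b1) (is_deriveM a2 b2))).
    by move=> u; rewrite Re_mul.
  by rewrite Re_add !Re_mul /GRing.scale /=; ring.
apply: (is_derive_ext (is_deriveD (is_deriveM a1 b2) (is_deriveM a2 b1))).
  by move=> u; rewrite Im_mul.
by rewrite Im_add !Im_mul /GRing.scale /=; ring.
Qed.

Lemma cderive_cst (c : C) : cderive (fun=> c) (fun=> 0).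
Proof. by move=> t; split; exact: is_derive_cst. Qed.

Lemma cderive_real : cderive (fun t => t%:C) (fun=> 1).
Proof. by move=> t; split; [exact: is_derive_id|exact: is_derive_cst]. Qed.

Lemma cderiveX A F n : cderive A F ->
  cderive (fun t => A t ^+ n.+1) (fun t => n.+1%:R * A t ^+ n * F t).
Proof.
move=> dA; elim: n => [|n IHn].
  by apply: (cderive_ext dA) => t; rewrite ?expr1 // expr0 !mul1r.
apply: (cderive_ext (cderiveM dA IHn)) => t; rewrite ?exprS //.
by rewrite -[n.+2%:R]natr1; ring.
Qed.

Lemma cderiveV A F : (forall t, A t != 0) -> cderive A F ->
  cderive (fun t => (A t)^-1) (fun t => - F t / A t ^+ 2).
Proof.
move=> A0 dA t; have [a1 a2] := dA t.
have n0 : Re (A t) ^+ 2 + Im (A t) ^+ 2 != 0.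
  apply: contraNneq (A0 t) => /eqP; rewrite paddr_eq0 ?sqr_ge0 // !sqrf_eq0.
  by move=> /andP[/eqP h1 /eqP h2]; apply/eqP/complex_ext.
(* This is the squared modulus of [A t ^+ 2], the denominator that arises when the square is
   inverted. *)
have n1 : (Re (A t) * Re (A t) - Im (A t) * Im (A t)) ^+ 2 +
    (Re (A t) * Im (A t) + Im (A t) * Re (A t)) ^+ 2 != 0.
  rewrite [X in X != 0](_ : _ = (Re (A t) ^+ 2 + Im (A t) ^+ 2) ^+ 2); last by ring.
  by rewrite expf_neq0.
have dN : is_derive t (1 : R) (fun u => Re (A u) ^+ 2 + Im (A u) ^+ 2)
    (2 * Re (A t) * Re (F t) + 2 * Im (A t) * Im (F t)).
  by apply: (is_derive_ext (is_deriveD (is_deriveX 2 a1) (is_deriveX 2 a2))).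
have dV := @is_deriveV _ (fun u => Re (A u) ^+ 2 + Im (A u) ^+ 2) _ _ _ n0 dN.
split.
  apply: (is_derive_ext (is_deriveM a1 dV)).
    by move=> u; rewrite Re_inv.
  rewrite Re_mul Re_opp Im_opp Re_inv Im_inv Re_mul Im_mul /GRing.scale /=; field.
  by apply/andP; split; [exact: n1|exact: n0].
apply: (is_derive_ext (is_deriveN (is_deriveM a2 dV))).
  by move=> u; rewrite Im_inv mulNr.
rewrite Im_mul Re_opp Im_opp Re_inv Im_inv Re_mul Im_mul /GRing.scale /=; field.
by apply/andP; split; [exact: n1|exact: n0].
Qed.

Lemma pvint_ext F G v : pvint F v -> F =1 G -> pvint G v.
Proof. by move=> h /funext <-. Qed.

Lemma pvintD F G v w : pvint F v -> pvint G w ->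
  pvint (fun t => F t + G t) (v + w).
Proof.
move=> [cF [A [dA lA]]] [cG [B [dB lB]]]; split.
  by move=> t; exact: cvgD (cF t) (cG t).
exists (fun t => A t + B t); split; first exact: cderiveD.
apply: (cvg_ext (cvgD lA lB)) => t /=.
by rewrite opprD addrACA.
Qed.

Lemma pvintZ c F v : pvint F v -> pvint (fun t => c * F t) (c * v).
Proof.
move=> [cF [A [dA lA]]]; split.
  by move=> t; exact: cvgM (cvg_cst _) (cF t).
exists (fun t => c * A t); split.
  apply: (cderive_ext (cderiveM (cderive_cst c) dA)) => // t.
  by rewrite mul0r add0r.
by apply: (cvg_ext (cvgM (cvg_cst (c : C^o)) lA)) => t /=; rewrite mulrBr.
Qed.

Lemma pvint0 : pvint (fun=> 0) 0.
Proof.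
split; first by move=> t; exact: cvg_cst.
exists (fun=> 0); split; first exact: cderive_cst.
by rewrite subrr; exact: cvg_cst.
Qed.

Lemma subC_neq0 (w : C) (t : R) : Im w != 0 -> t%:C - w != 0.
Proof.
move=> w0; apply: contraNneq w0 => /eqP.
by rewrite subr_eq0 => /eqP <-.
Qed.

Lemma continuous_subC (w : C) : continuous ((fun t : R => t%:C - w) : R -> C^o).
Proof.
by move=> t; apply: cvgB; [apply: cvg_realC; exact: cvg_id|exact: cvg_cst].
Qed.

Lemma continuous_subCV (w : C) k : Im w != 0 ->
  continuous ((fun t : R => (t%:C - w)^-1 ^+ k) : R -> C^o).
Proof.
move=> w0 t; rewrite /continuous_at; elim: k => [|k IHk].
  by rewrite expr0; under eq_fun do rewrite expr0; exact: cvg_cst.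
rewrite exprS; under eq_fun do rewrite exprS.
have lw : (u%:C - w : C^o) @[u --> t] --> (t%:C - w : C^o) by exact: continuous_subC.
have lV : ((u%:C - w)^-1 : C^o) @[u --> t] --> ((t%:C - w)^-1 : C^o).
  exact: cvgV (subC_neq0 t w0) lw.
exact: cvgM lV IHk.
Qed.

Lemma cvg_invr_pinfty : (t^-1 : R) @[t --> +oo] --> 0.
Proof. by apply/gtr0_cvgV0; [near=> t; near: t; exact: nbhs_pinfty_gt|exact: cvg_id].
Unshelve. all: by end_near. Qed.

Lemma cvg_invr_ninfty : (t^-1 : R) @[t --> -oo] --> 0.
Proof. by apply/ltr0_cvgV0; [near=> t; near: t; exact: nbhs_ninfty_lt|exact: cvg_id].
Unshelve. all: by end_near. Qed.

Lemma cvg_subCV_infty (u : R -> R) (w : C) k :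
  (u t)^-1 @[t --> +oo] --> 0 -> (\forall t \near +oo, u t != 0) ->
  (((u t)%:C - w)^-1 ^+ k.+1 : C^o) @[t --> +oo] --> (0 : C^o).
Proof.
move=> u0 un0.
have /monicP : ('X - w%:P) ^+ k.+1 \is monic by rewrite monic_exp ?monicXsubC.
rewrite /lead_coef size_exp_XsubC /= => lq.
pose q := ('X - w%:P) ^+ k.+1.
have h : ((1 : {poly C}).[(u t)%:C] / q.[(u t)%:C] : C^o) @[t --> +oo] -->
    ((1 : {poly C})`_k.+1 / q`_k.+1 : C^o).
  by apply: cvg_ratio_infty; rewrite ?size_poly1 ?size_exp_XsubC ?lq ?oner_eq0.
rewrite lq coef1 mul0r in h; apply: (cvg_ext h) => t.
by rewrite hornerC horner_exp hornerXsubC div1r exprVn.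
Qed.

(** The antiderivative [- (t - w)^-(k+1) / (k + 1)] vanishes at both infinities. *)
Lemma pvint_pow (w : C) k : Im w != 0 ->
  pvint (fun t => (t%:C - w)^-1 ^+ k.+2) 0.
Proof.
move=> w0; split; first exact: continuous_subCV.
exists (fun t => - k.+1%:R^-1 * (t%:C - w)^-1 ^+ k.+1); split.
  have dl := cderiveD cderive_real (cderive_cst (- w)).
  have dX := cderiveX k (cderiveV (fun t => subC_neq0 t w0) dl).
  apply: (cderive_ext (cderiveM (cderive_cst (- k.+1%:R^-1)) dX)) => // t.
  rewrite mul0r add0r addr0 mulNr -exprVn -(addn2 k) exprD -!mulrA mulKf ?pnatr_eq0 //.
  by rewrite mulN1r mulrN opprK.
pose c : C^o := - k.+1%:R^-1.
have n0 : \forall t \near +oo, (t : R) != 0.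
  by near=> t; rewrite gt_eqF //; near: t; exact: nbhs_pinfty_gt.
have l1 : ((t%:C - w)^-1 ^+ k.+1 : C^o) @[t --> +oo] --> (0 : C^o).
  exact: (@cvg_subCV_infty id w k cvg_invr_pinfty n0).
have l2 : (((- t)%:C - w)^-1 ^+ k.+1 : C^o) @[t --> +oo] --> (0 : C^o).
  apply: cvg_subCV_infty.
    under eq_fun do rewrite invrN; rewrite -oppr0; exact: cvgN cvg_invr_pinfty.
  by near do rewrite oppr_eq0.
have h := cvgB (cvgM (cvg_cst c) l1) (cvgM (cvg_cst c) l2).
by rewrite !mulr0 subrr in h; exact: h.
Unshelve. all: by end_near. Qed.

Lemma cvg_atan_pinfty (c b : R) : b != 0 ->
  atan ((t - c) / b) @[t --> +oo] --> Num.sg b * (pi / 2).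
Proof.
have pos (d : R) : 0 < d -> atan ((t - c) / d) @[t --> +oo] --> pi / 2.
  move=> d0; have h : (t - c) / d @[t --> +oo] --> +oo.
    by apply: gt0_cvgMly; [rewrite invr_gt0|exact: cvg_addrr].
  exact: (@cvg_comp _ _ _ (fun t => (t - c) / d) (@atan R) _ _ _ h (@cvgy_atan R)).
rewrite neq_lt => /orP[b0|b0]; last by rewrite gtr0_sg // mul1r; exact: pos.
have nb : 0 < - b by rewrite oppr_gt0.
rewrite ltr0_sg // mulN1r.
have h : - atan ((t - c) / - b) @[t --> +oo] --> - (pi / 2) by exact: cvgN (pos _ nb).
apply: (cvg_ext h) => t /=.
by rewrite -atanN invrN mulrN opprK.
Qed.

Lemma lead_prod_XsubC (F : idomainType) (s : seq F) :
  (\prod_(z <- s) ('X - z%:P))`_(size s) = 1.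
Proof.
have /monicP := monic_prod_XsubC s predT id.
by rewrite /lead_coef size_prod_XsubC.
Qed.

Lemma horner_prod_XsubC (F : comNzRingType) (s : seq F) x :
  (\prod_(z <- s) ('X - z%:P)).[x] = \prod_(z <- s) (x - z).
Proof. by rewrite horner_prod; apply: eq_bigr => z _; rewrite hornerXsubC. Qed.

(** An antiderivative is [ln |t - w| + i atan ((t - Re w) / Im w)]. The logarithms at [t] and [- t]
    cancel in the limit, and the arctangent increases or decreases by [pi] according to the
    half-plane of [w]. *)
Lemma pvint_inv (w : C) : Im w != 0 ->
  pvint (fun t => (t%:C - w)^-1) ((Num.sg (Im w) * pi)*i).
Proof.
move=> w0; split; first exact: (@continuous_subCV w 1 w0).
pose a := Re w; pose b := Im w.
pose N (t : R) := (t - a) ^+ 2 + b ^+ 2.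
have N0 t : 0 < N t by rewrite ltr_wpDl ?sqr_ge0 // exprn_even_gt0.
have dta (t : R) : is_derive t (1 : R) (fun u => u - a) 1.
  have h := is_deriveB (is_derive_id t (1 : R)) (is_derive_cst a t (1 : R)).
  by apply: (is_derive_ext h); rewrite ?subr0.
have dN (t : R) : is_derive t (1 : R) N (2 * (t - a)).
  apply: (is_derive_ext
    (is_deriveD (is_deriveX 2 (dta t)) (is_derive_cst (b ^+ 2) t 1))) => //.
  by rewrite /GRing.scale /= mulr1 addr0.
have sN t : (t%:C - w)^-1 = ((t - a) / N t) +i* (b / N t).
  rewrite /N /b /a; case: w {w0 a b N N0 dta dN} => a b /=.
  by apply: complex_ext; rewrite ?Re_inv ?Im_inv /= sub0r ?opprK sqrrN.
exists (fun t => (ln (N t) / 2) +i* atan ((t - a) / b)); split.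
  move=> t; rewrite sN; split => /=.
    have dl : is_derive t (1 : R) (fun u => ln (N u)) ((N t)^-1 * (2 * (t - a))).
      exact: (@is_derive1_comp _ (@ln R) N t _ _ (is_derive1_ln (N0 t)) (dN t)).
    have h := is_deriveM dl (is_derive_cst (2^-1 : R) t (1 : R)).
    apply: (is_derive_ext h) => //.
    by rewrite /GRing.scale /= mulr0 add0r; field; rewrite gt_eqF.
  have db : is_derive t (1 : R) (fun u => (u - a) / b) b^-1.
    have h := is_deriveM (dta t) (is_derive_cst (b^-1 : R) t (1 : R)).
    apply: (is_derive_ext h) => //.
    by rewrite /GRing.scale /= mulr0 add0r mulr1.
  have dA := @is_derive1_comp _ (@atan R) _ t _ _ (is_derive1_atan _) db.
  apply: (is_derive_ext dA) => //.
  rewrite /N; field; apply/andP; split; [exact/lt0r_neq0/(N0 t)|exact: w0].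
have ratio : N t / N (- t) @[t --> +oo] --> (1 : R).
  (* On the real line [p] is [N t] and [q] is [N (- t)], two monic polynomials of degree 2. *)
  pose p := \prod_(z <- [:: w; w^*]) ('X - z%:P).
  pose q := \prod_(z <- [:: - w; - w^*]) ('X - z%:P).
  have n0 : \forall t \near +oo, (t : R) != 0.
    by near=> t; rewrite gt_eqF //; near: t; exact: nbhs_pinfty_gt.
  have h : (p.[t%:C] / q.[t%:C] : C^o) @[t --> +oo] --> (p`_2 / q`_2 : C^o).
    apply: (@cvg_ratio_infty R +oo _ id) => //; first exact: cvg_invr_pinfty.
    - by rewrite size_prod_XsubC.
    - by rewrite size_prod_XsubC.
    - by rewrite (@lead_prod_XsubC C [:: - w; - w^*]) oner_eq0.
  rewrite (@lead_prod_XsubC C [:: - w; - w^*]) (@lead_prod_XsubC C [:: w; w^*]) in h.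
  rewrite divr1 in h; apply: (cvg_ext (cvg_complex_Re h)) => t.
  rewrite !horner_prod_XsubC !big_cons !big_nil !mulr1.
  have -> : (t%:C - w) * (t%:C - w^*) = (N t)%:C.
    rewrite /N /a /b; case: (w) => c d; apply: complex_ext => /=; ring.
  have -> : (t%:C - - w) * (t%:C - - w^*) = (N (- t))%:C.
    rewrite /N /a /b; case: (w) => c d; apply: complex_ext => /=; ring.
  by rewrite -rmorphV ?unitfE ?gt_eqF // -rmorphM.
apply: cvg_complexP => /=.
  have h : ln (N t / N (- t)) / 2 @[t --> +oo] --> (0 : R).
    have h1 := @cvg_comp _ _ _ _ (@ln R) _ _ _ ratio (continuous_ln ltr01).
    rewrite ln1 in h1; have h2 := cvgM h1 (cvg_cst (2^-1 : R)).
    by rewrite mul0r in h2; exact: h2.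
  apply: (cvg_ext h) => t.
  by rewrite ln_div ?posrE // mulrBl.
have h1 := cvg_atan_pinfty a w0.
have h2 := cvg_atan_pinfty (- a) w0.
have h : atan ((t - a) / b) + atan ((t - - a) / b) @[t --> +oo] --> Num.sg b * pi.
  by rewrite [X in _ * X]splitr mulrDr; exact: cvgD h1 h2.
apply: (cvg_ext h) => t /=.
congr (_ + _); rewrite -atanN -mulNr; congr (atan (_ / _)); ring.
Unshelve. all: by end_near. Qed.

End PrincipalValue.

(** * Fractions with all poles in one half-plane, and the passage to the Lebesgue integral *)

Section PVRational.
Variable R : realType.
Local Notation C := R[i].
Local Notation Re := (@complex.Re R).
Local Notation Im := (@complex.Im R).

Lemma prod_subC_neq0 (s : seq C) (t : R) : {in s, forall w, Im w != 0} ->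
  \prod_(z <- s) (t%:C - z) != 0.
Proof.
by move=> s0; rewrite prodf_seq_neq0; apply/allP => z /s0; exact: subC_neq0.
Qed.

(** Induction on the number of factors. If all are equal, this is a power. Otherwise two distinct
    poles [w] and [u] are separated by [1 / ((t - w)(t - u)) = (1 / (t - w) - 1 / (t - u)) / (w -
    u)]; both resulting shorter products have the same principal value, because [v] is common to all
    poles, so the difference has value 0. *)
Lemma pvint_prodV (v : C) (s : seq C) : s != [::] ->
  {in s, forall w, Im w != 0 /\ pvint (fun t => (t%:C - w)^-1) v} ->
  pvint (fun t => (\prod_(z <- s) (t%:C - z))^-1) (if size s == 1%N then v else 0).
Proof.
have [n] := ubnP (size s); elim: n s => // n IHn [//|w [|w' s]] sn _ hs.
  have [_ pw] := hs w (mem_head _ _).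
  by apply: (pvint_ext pw) => t; rewrite big_seq1.
have [w0 _] := hs w (mem_head _ _).
have [sw|] := boolP (all (pred1 w) (w' :: s)).
  apply: (pvint_ext (pvint_pow (size s) w0)) => t.
  by rewrite big_cons (all_pred1P _ _ sw) big_nseq iter_mulr_1 -exprS exprVn.
case/allPn => u us /= uw; have ps := perm_to_rem us.
pose r := rem u (w' :: s); rewrite -/r in ps.
have sr : (size (w' :: s) = (size r).+1)%N by rewrite (perm_size ps).
have P t : \prod_(z <- [:: w, w' & s]) (t%:C - z) =
   (t%:C - w) * ((t%:C - u) * \prod_(z <- r) (t%:C - z)).
  by rewrite big_cons (perm_big _ ps) /= big_cons.
have mem y : y \in [:: w, u & r] -> y \in [:: w, w' & s].
  by rewrite in_cons [in X in _ -> X]in_cons (perm_mem ps).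
have pv y : y \in [:: w; u] ->
    pvint (fun t => (\prod_(z <- y :: r) (t%:C - z))^-1)
      (if size (y :: r) == 1%N then v else 0).
  move=> yw; apply: IHn => //; first by rewrite /= -sr /=.
  move=> z zr; apply: hs; apply: mem; move: zr yw.
  by rewrite !inE => /orP[/eqP-> /orP[->|->]|->]; rewrite ?orbT.
have wu : w - u != 0 by rewrite subr_eq0 eq_sym.
have := pvintZ (w - u)^-1 (pvintD (pv w (mem_head _ _)) (pvintZ (-1)
  (pv u (mem_last _ [:: u])))).
rewrite [size _ == _]/= mulN1r subrr mulr0 => h.
apply: (pvint_ext h) => t; rewrite P !big_cons.
have r0 : \prod_(z <- r) (t%:C - z) != 0.
  apply: prod_subC_neq0 => z zr; apply: (hs z (mem z _)).1.
  by rewrite !inE zr !orbT.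
have tw := subC_neq0 t w0.
have um : u \in [:: w, u & r] by rewrite !inE eqxx orbT.
have tu := subC_neq0 t (hs u (mem u um)).1.
field.
by rewrite r0 tw tu.
Qed.

(** Poles are split off one at a time by [H = q (X - w) + H(w)]: the quotient goes to the induction
    hypothesis, and the constant contributes only when a single pole is left. *)
Lemma pvint_frac (v : C) (s : seq C) (H : {poly C}) :
  {in s, forall w, Im w != 0 /\ pvint (fun t => (t%:C - w)^-1) v} ->
  (size H <= size s)%N ->
  pvint (fun t => H.[t%:C] / \prod_(z <- s) (t%:C - z)) (v * H`_(size s).-1).
Proof.
elim: s H => [|w s IHs] H hs sH.
  have -> : H = 0 by apply/eqP; rewrite -size_poly_leq0.
  rewrite coef0 mulr0; apply: (pvint_ext (pvint0 R)) => t.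
  by rewrite horner0 mul0r.
have [w0 pw] := hs w (mem_head _ _).
pose q := H %/ ('X - w%:P); pose c := H.[w].
have HE : H = q * ('X - w%:P) + c%:P by rewrite {1}(divp_eq H ('X - w%:P)) modp_XsubC.
have sq : (size q <= size s)%N.
  by rewrite size_divp ?polyXsubC_eq0 // size_XsubC subn1 -ltnS; case: size sH.
have hs' : {in s, forall w, Im w != 0 /\ pvint (fun t => (t%:C - w)^-1) v}.
  by move=> z zs; apply: hs; rewrite inE zs orbT.
have := pvintD (IHs q hs' sq) (pvintZ c (@pvint_prodV v (w :: s) isT hs)).
have -> : v * q`_(size s).-1 + c * (if size (w :: s) == 1%N then v else 0) =
    v * H`_(size (w :: s)).-1.
  case: (s) sq => [|w' s'] /= sq.
    have q0 : q = 0 by apply/eqP; rewrite -size_poly_leq0.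
    by rewrite HE q0 mul0r add0r coef0 mulr0 add0r coefC mulrC.
  rewrite mulr0 addr0 HE mulrBr coefD coefB coefMX coefC /= addr0.
  by rewrite coefMC [q`_(size s').+1]nth_default // mul0r subr0.
move=> h; apply: (pvint_ext h) => t.
have r0 := prod_subC_neq0 t (fun z zs => (hs' z zs).1).
have tw := subC_neq0 t w0.
rewrite big_cons [X in _ = X.[_] / _]HE !hornerE; field.
by rewrite r0 tw.
Qed.

Local Notation mu := (@lebesgue_measure R).

(** On growing symmetric intervals the integral is a difference of values of [G]; dominated
    convergence, with [|g|] as the bound, identifies its limit with the Lebesgue integral. *)
Lemma integral_pv (g G : R -> R) (l : R) : continuous g ->
  (forall t, is_derive t (1 : R) G (g t)) ->
  G t - G (- t) @[t --> +oo] --> l ->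
  mu.-integrable setT (fun t => (g t)%:E) -> \int[mu]_t g t = l.
Proof.
move=> cg dG lG ig.
pose I n : set R := [set` `[- n.+1%:R, n.+1%:R]%R].
have FTC n : (\int[mu]_(t in I n) (g t)%:E)%E = (G n.+1%:R - G (- n.+1%:R))%:E.
  rewrite (@continuous_FTC2 _ g G) //.
  - by rewrite gtrN ?ltr0n.
  - exact: continuous_subspaceT.
  - have cG : continuous G.
      by move=> t; apply/differentiable_continuous/derivable1_diffP; exact: ex_derive.
    split.
    + by move=> t _; exact: ex_derive.
    + by apply: cvg_at_right_filter; exact: cG.
    + by apply: cvg_at_left_filter; exact: cG.
  - by move=> t _; rewrite derive1E; exact: derive_val.
pose f_ n t := ((g \_ (I n)) t)%:E.
have mg : measurable_fun setT g by exact: continuous_measurable_fun.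
have h : (\int[mu]_t f_ n t @[n --> \oo] --> \int[mu]_t (g t)%:E)%E.
  apply: (@dominated_cvg _ _ _ mu setT measurableT f_ (fun t => (g t)%:E)
    (fun t => `|(g t)%:E|%E)).
  - move=> n; apply/measurable_EFinP/(measurable_restrictT _ (measurable_itv _)).
    exact: measurable_funS mg.
  - move=> t _; apply: cvg_near_cst.
    have : \forall n \near \oo, `|t| <= n%:R by exact: nbhs_infty_ger.
    apply: filterS => n tn; rewrite /f_ patchE mem_set // /I /= in_itv /= -ler_norml.
    by rewrite (le_trans tn) // ler_nat.
  - by [].
  - exact: integrable_abse.
  - move=> n t _; rewrite /f_ patchE; case: ifP => // _.
    by rewrite abse0 abse_ge0.
have e n : (\int[mu]_t f_ n t)%E = (G n.+1%:R - G (- n.+1%:R))%:E.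
  rewrite -FTC [RHS]integral_mkcond; apply: eq_integral => t _.
  by rewrite /f_ !patchE; case: ifP.
have lG' : (G n.+1%:R - G (- n.+1%:R))%:E @[n --> \oo] --> l%:E.
  apply: cvg_EFin; first by near=> n.
  have n1 : (n.+1%:R : R) @[n --> \oo] --> +oo 
    by rewrite (cvg_shiftS (fun n => n%:R : R)); exact: cvgr_idn.
  exact: (cvg_comp (fun n : nat => n.+1%:R) (fun t => G t - G (- t)) n1 lG).
rewrite /Rintegral; suff -> : (\int[mu]_t (g t)%:E)%E = l%:E by [].
have h' : (G n.+1%:R - G (- n.+1%:R))%:E @[n --> \oo] --> (\int[mu]_t (g t)%:E)%E.
  exact: (cvg_ext h).
exact: cvg_unique h' lG'.
Unshelve. all: by end_near. Qed.

End PVRational.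

(** * The quadrature formula *)

Section Quadrature.
Variable R : realType.
Local Notation C := R[i].
Local Notation Re := (@complex.Re R).
Local Notation Im := (@complex.Im R).
Local Notation mu := (@lebesgue_measure R).

Lemma Rintegral_pv_Re (F : R -> C) v : pvint F v ->
  mu.-integrable setT (fun t => (Re (F t))%:E) -> \int[mu]_t Re (F t) = Re v.
Proof.
move=> [cF [A [dA lA]]]; apply: (integral_pv (G := fun t => Re (A t))) => [t|t|].
- exact: cvg_complex_Re (cF t).
- exact: (dA t).1.
- by apply: (cvg_ext (cvg_complex_Re lA)) => t; rewrite Re_add Re_opp.
Qed.

Lemma Rintegral_pv_Im (F : R -> C) v : pvint F v ->
  mu.-integrable setT (fun t => (Im (F t))%:E) -> \int[mu]_t Im (F t) = Im v.
Proof.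
move=> [cF [A [dA lA]]]; apply: (integral_pv (G := fun t => Im (A t))) => [t|t|].
- exact: cvg_complex_Im (cF t).
- exact: (dA t).2.
- by apply: (cvg_ext (cvg_complex_Im lA)) => t; rewrite Im_add Im_opp.
Qed.

Lemma cintegral_pv (F : R -> C) v : pvint F v -> cintegrable F -> cintegral F = v.
Proof.
move=> pF [iRe iIm]; apply: complex_ext => /=.
  exact: Rintegral_pv_Re.
exact: Rintegral_pv_Im.
Qed.

Lemma horner_deriv_prod_XsubC (F : fieldType) (s : seq F) (t : F) :
  {in s, forall z, t - z != 0} ->
  (\prod_(z <- s) ('X - z%:P))^`().[t] =
  (\prod_(z <- s) (t - z)) * \sum_(z <- s) (t - z)^-1.
Proof.
elim: s => [|z s IHs] s0; first by rewrite !big_nil derivC horner0 mulr0.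
rewrite !big_cons derivM derivXsubC mul1r hornerD hornerM hornerXsubC.
rewrite IHs; last by move=> y ys; apply: s0; rewrite inE ys orbT.
rewrite horner_prod_XsubC mulrDr mulrA; congr (_ + _).
by rewrite mulrAC mulfV ?mul1r // s0 // mem_head.
Qed.

Section Nodes.
Variable U : seq C.
Hypothesis U_gt0 : {in U, forall w, 0 < Im w}.

(** In the application [U] lists each [z_k] exactly [m n_k] times, so that [upoly / lpoly] is the
    [m]-th power of [Bstar] and [poisson] is [m] times [mustar]. *)
Definition upoly : {poly C} := \prod_(z <- U) ('X - z%:P).
Definition lpoly : {poly C} := \prod_(z <- map conjc U) ('X - z%:P).
(** Sum of the Poisson kernels of the upper half-plane at the points of [U], up to the factor [pi];
    it is half the derivative of the argument of [upoly / lpoly]. *)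
Definition poisson (t : R) : R := 
  \sum_(w <- U) Im w / ComplexField.Normc.normc (t%:C - w^*) ^+ 2.
Local Notation A := upoly.
Local Notation B := lpoly.
Local Notation K := (A^`() * B - A * B^`()).

Lemma U_neq0 : {in U, forall w, Im w != 0}.
Proof. by move=> w /U_gt0/lt0r_neq0. Qed.

Lemma conjU_lt0 : {in map conjc U, forall w, Im w < 0}.
Proof. by move=> _ /mapP[w /U_gt0 + ->]; case: w => a b /=; rewrite oppr_lt0. Qed.

Lemma conjU_neq0 : {in map conjc U, forall w, Im w != 0}.
Proof. by move=> w /conjU_lt0 h; rewrite lt_eqF. Qed.

Lemma coprime_ulpoly : coprimep A B.
Proof.
rewrite /lpoly; have := conjU_lt0; elim: (map conjc U) => [|z s IHs] hs.
  by rewrite big_nil coprimep1.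
rewrite big_cons coprimepMr IHs ?andbT; last first.
  by move=> y ys; apply: hs; rewrite inE ys orbT.
rewrite coprimep_XsubC /upoly root_prod_XsubC; apply/negP => /U_gt0.
by rewrite ltNge ltW // hs // mem_head.
Qed.

(** [K / (A B)] is the difference [A' / A - B' / B] of logarithmic derivatives, in which [w] and its
    conjugate together give [2 i Im w / |t - conj w|^2]. *)
Lemma wronskian_poisson (t : R) :
  K.[t%:C] = 2 * 'i%C * (poisson t)%:C * (A.[t%:C] * B.[t%:C]).
Proof.
rewrite hornerD hornerN !hornerM.
rewrite !horner_deriv_prod_XsubC => [|z zU|z zU]; last 2 first.
- exact: subC_neq0 (conjU_neq0 zU).
- exact: subC_neq0 (U_neq0 zU).
rewrite -!horner_prod_XsubC -/upoly -/lpoly.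
transitivity ((\sum_(z <- U) (t%:C - z)^-1 -
    \sum_(z <- map conjc U) (t%:C - z)^-1) * (A.[t%:C] * B.[t%:C])); first by ring.
congr (_ * _); rewrite big_map -sumrB /poisson rmorph_sum mulr_sumr.
apply: eq_big_seq => w wU.
have w0 := U_neq0 wU.
have t1 := subC_neq0 t w0.
have t2 : t%:C - w^* != 0.
  by apply: subC_neq0; case: (w) w0 => a b /=; rewrite oppr_eq0.
have nE : (ComplexField.Normc.normc (t%:C - w^*) ^+ 2)%:C = (t%:C - w) * (t%:C - w^*).
  case: (w) => a b /=; rewrite sqr_sqrtr ?addr_ge0 ?sqr_ge0 //.
  by apply: complex_ext => /=; ring.
rewrite rmorphM fmorphV /= nE.
have wE : w = w^* + 2 * 'i%C * (Im w)%:C by rewrite mulrAC -subcJ addrC subrK.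
apply: (@mulIf _ ((t%:C - w) * (t%:C - w^*))); first by rewrite mulf_neq0.
rewrite mulrBl mulKf // [X in _ - _ * X]mulrC mulKf // -!mulrA mulVf ?mulf_neq0 //.
by rewrite {2}wE; ring.
Qed.

(** Common form of both formulas, for principal values. For [N > 0] the bound on [size G] makes [F]
    decay at least like [t^-2], which yields opposite leading coefficients for [a] and [b] and a
    limit of the summand at infinity. For [N = 0] it forces [G = 0]. *)
Lemma notch_quadrature N (G : {poly C}) (e : C)
    (x : 'I_N -> one_point_compactification R) :
  size U = N -> (size G <= (N + N).-1)%N -> injective x ->
  (forall p, (exists k, x k = p) <->
     (if p is Some t then A.[t%:C] / B.[t%:C] else 1) = e) ->
  let F := fun t : R => G.[t%:C] / (A.[t%:C] * B.[t%:C]) in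
  exists s : 'I_N -> C,
    (forall k, @summand R (C^o : topologicalType)
       (fun t => F t / (poisson t)%:C) (x k) (s k)) /\
    pvint F (pi%:C * \sum_k s k).
Proof.
move=> sU; case: N / sU x => x sG injx xroots F.
have A0 (t : R) : A.[t%:C] != 0.
  by rewrite horner_prod_XsubC prod_subC_neq0 //; exact: U_neq0.
have B0 (t : R) : B.[t%:C] != 0.
  by rewrite horner_prod_XsubC prod_subC_neq0 //; exact: conjU_neq0.
have [U0|[k Uk]] : size U = 0%N \/ exists k, size U = k.+1.
- by case: (size U) => [|k]; [left|right; exists k].
- have G0 : G = 0 by apply/eqP; rewrite -size_poly_leq0 (leq_trans sG) // U0.
  exists (fun=> 0); split => [i|]; first by have := ltn_ord i; rewrite {2}U0.
  rewrite big1 // mulr0; apply: (pvint_ext (pvint0 R)) => t.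
  by rewrite /F G0 horner0 mul0r.
have mA : A \is monic by exact: monic_prod_XsubC.
have mB : B \is monic by exact: monic_prod_XsubC.
have sA : size A = k.+2 by rewrite size_prod_XsubC Uk.
have sB : size B = k.+2 by rewrite size_prod_XsubC size_map Uk.
have sG' : (size G <= (k + k).+1)%N by rewrite (leq_trans sG) // Uk addnS.
have [a [b [sa sb GE]]] : exists a b : {poly C},
    [/\ (size a <= k.+1)%N, (size b <= k.+1)%N & G = a * B + b * A].
  apply: coprimep_decomp => //; first exact: coprime_ulpoly.
  by rewrite (leq_trans sG') // addnS ltnS addSn leqnSn.
(* The sum is the coefficient of [X^(2k+1)] in [G], beyond its degree. *)
have ab : a`_k + b`_k = 0.
  have A1 : A`_k.+1 = 1 by move: mA; rewrite monicE /lead_coef sA => /eqP.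
  have B1 : B`_k.+1 = 1 by move: mB; rewrite monicE /lead_coef sB => /eqP.
  have : G`_(k + k.+1) = 0 by rewrite nth_default // addnS.
  by rewrite GE coefD !coefM_top ?sA ?sB // A1 B1 !mulr1.
have FK (t : R) : F t / (poisson t)%:C = 2 * 'i%C * (G.[t%:C] / K.[t%:C]).
  have i0 : 2 * 'i%C != 0 :> C by rewrite mulf_neq0 ?pnatr_eq0 // eq_complex /= oner_eq0 andbF.
  have iM (u v w : C) : (u * v * w)^-1 = u^-1 * v^-1 * w^-1 by rewrite !invfM.
  rewrite wronskian_poisson /F iM.
  transitivity (2 * 'i%C * (2 * 'i%C)^-1 *
    (G.[t%:C] / (A.[t%:C] * B.[t%:C]) / (poisson t)%:C)); last by ring.
  by rewrite mulfV // mul1r.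
(* [D] selects the finite nodes; the default 0 is taken only at the node at infinity, outside
   [D]. *)
pose y i := odflt 0 (x i).
pose D := [pred i | x i != None].
have xD i : D i -> x i = Some (y i) by rewrite /D /y /=; case: (x i).
have injy : {in D &, injective (fun i => (y i)%:C)}.
  move=> i j Di Dj /complexI yij; apply: injx.
  by rewrite (xD i) // (xD j) // yij.
have AB i : D i -> A.[(y i)%:C] = e * B.[(y i)%:C].
  move=> Di; have : exists j, x j = Some (y i) by exists i; exact: xD.
  by move/xroots => <-; rewrite divfK.
pose s i := 2 * 'i%C * (if x i is Some t then G.[t%:C] / K.[t%:C]
                        else G`_(k + k) / K`_(k + k)).
(* The poles above the axis give [pi i a_k], those below give [- pi i b_k], which is again
   [pi i a_k]. *)
have pvF : pvint F (2 * 'i%C * pi%:C * a`_k).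
  have hU : {in U, forall w, Im w != 0 /\ pvint (fun t => (t%:C - w)^-1) (pi *i)}.
    move=> w wU; have w0 := U_neq0 wU; split => //.
    by have := pvint_inv w0; rewrite gtr0_sg ?mul1r ?U_gt0.
  have hc : {in map conjc U,
      forall w, Im w != 0 /\ pvint (fun t => (t%:C - w)^-1) ((- pi) *i)}.
    move=> w wU; have w0 := conjU_neq0 wU; split => //.
    by have := pvint_inv w0; rewrite ltr0_sg ?mulN1r ?conjU_lt0.
  have h1 := @pvint_frac _ _ _ a hU; rewrite Uk in h1.
  have h2 := @pvint_frac _ _ _ b hc; rewrite size_map Uk in h2.
  have := pvintD (h1 sa) (h2 sb).
  have -> : pi *i * a`_k.+1.-1 + (- pi) *i * b`_k.+1.-1 = 2 * 'i%C * pi%:C * a`_k :> C.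
    have -> : b`_k.+1.-1 = - a`_k by apply/eqP; rewrite -addr_eq0 addrC ab.
    have -> : (- pi) *i = - (pi *i) :> C by apply: complex_ext; rewrite /= ?oppr0.
    have -> : pi *i = 'i%C * pi%:C :> C by apply: complex_ext => /=; ring.
    by rewrite /=; ring.
  move=> h; apply: (pvint_ext h) => t.
  rewrite -!horner_prod_XsubC -/upoly -/lpoly /F GE hornerD !hornerM.
  by field; rewrite A0 B0.
have BD0 i : D i -> B.[(y i)%:C] != 0 by [].
(* A node at infinity forces [e = 1]; by injectivity of [x] it is the only one, and [k] finite nodes
   remain. *)
have infP : (exists k0, x k0 = None) ->
    [/\ (size K <= (k + k).+1)%N, K`_(k + k) != 0 & \sum_i s i = 2 * 'i%C * a`_k].
  move=> [k0 xk0].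
  have e1 : e = 1 by apply/esym/(xroots None).1; exists k0.
  have DE : D =i predC1 k0.
    move=> j; rewrite !inE; congr (~~ _); apply/eqP/eqP => [|-> //].
    by rewrite -xk0 => /injx.
  have cardD : #|D| = k by rewrite (eq_card DE) cardC1 card_ord Uk.
  have AB1 i : D i -> A.[(y i)%:C] = B.[(y i)%:C] by move=> /AB; rewrite e1 mul1r.
  have := sum_roots_eq1 injy cardD coprime_ulpoly mA mB sA sB AB1 BD0 sa sb ab.
  rewrite -GE => -[sK K0 sumK]; split => //.
  rewrite -sumK /s (bigD1 k0) //= xk0 addrC mulrDr mulr_sumr; congr (_ + _).
  rewrite (eq_bigl D) => [|j]; last by rewrite -[RHS]/(j \in D) DE.
  by apply: eq_bigr => j Dj; rewrite (xD j).
have sumF : \sum_i s i = 2 * 'i%C * a`_k.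
  (* Without a node at infinity [e] differs from 1, and all [k + 1] nodes are finite. *)
  have [/infP[]//|noinf] := pselect (exists k0, x k0 = None).
  have DT i : D i by apply/negP => /eqP xi; apply: noinf; exists i.
  have e1 : e != 1.
    by apply/eqP => e1; apply: noinf; apply/(xroots None).2.
  have cardD : #|D| = k.+1.
    by rewrite -Uk -[RHS]card_ord; apply: eq_card => i; exact: DT.
  rewrite -(sum_roots_neq1 injy cardD e1 mA mB sA sB AB BD0 sa sb ab) -GE /s.
  rewrite mulr_sumr (eq_bigl D) => [|i]; last by rewrite DT.
  by apply: eq_bigr => j Dj; rewrite (xD j).
exists s; split; last first.
  by have -> : pi%:C * (\sum_i s i) = 2 * 'i%C * pi%:C * a`_k by rewrite sumF; ring.
move=> i; rewrite /summand /s; case xi : (x i) => [t|]; first exact/esym/FK.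
have [sK K0 _] := infP (ex_intro _ _ xi).
have lim (H : set_system R) : Filter H -> (t : R)^-1 @[t --> H] --> 0 ->
    (\forall t \near H, t != 0) ->
    (F t / (poisson t)%:C : C^o) @[t --> H] -->
      (2 * 'i%C * (G`_(k + k) / K`_(k + k)) : C^o).
  move=> FH H0 Hn0.
  have h : (2 * 'i%C * (G.[t%:C] / K.[t%:C]) : C^o) @[t --> H] -->
      (2 * 'i%C * (G`_(k + k) / K`_(k + k)) : C^o).
    exact: cvgM (cvg_cst _) (cvg_ratio_infty H0 Hn0 sG' sK K0).
  by apply: (cvg_ext h) => t; rewrite FK.
split; apply: lim.
- exact: cvg_invr_pinfty.
- by near=> t; rewrite gt_eqF //; near: t; exact: nbhs_pinfty_gt.
- exact: cvg_invr_ninfty.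
- by near=> t; rewrite lt_eqF //; near: t; exact: nbhs_ninfty_lt.
Unshelve. all: by end_near. Qed.
End Nodes.
End Quadrature.

(** * Notches at infinity and integrability *)

Section Integrability.
Variable R : realType.
Local Notation C := R[i].
Local Notation Re := (@complex.Re R).
Local Notation Im := (@complex.Im R).
Local Notation mu := (@lebesgue_measure R).

Lemma expi_eq1 (phi : R) : 1 = expi phi <-> exists j : int, phi = j%:~R * (2 * pi).
Proof.
have per (a : R) (j : int) : cos (a + j%:~R * (2 * pi)) = cos a /\ 
    sin (a + j%:~R * (2 * pi)) = sin a.
  have pern (n : nat) (b : R) : cos (b + n%:R * (2 * pi)) = cos b /\
      sin (b + n%:R * (2 * pi)) = sin b.
    by rewrite !mulr_natl (periodicn (@cosD2pi R)) (periodicn (@sinD2pi R)).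
  case: (intP j) => [|n|n]; first by rewrite mul0r addr0.
    exact: pern.
  have [h1 h2] := pern n.+1 (a - n.+1%:R * (2 * pi)).
  by rewrite rmorphN mulNr -h1 -h2 subrK.
split=> [/eqP|[j ->]]; last first.
  by have [c s] := per 0 j; rewrite add0r in c s; rewrite /expi c s cos0 sin0.
rewrite eq_complex /= => /andP[/eqP c1 _].
have pi2 : 0 < 2 * pi :> R by rewrite mulr_gt0 // pi_gt0.
pose j := Num.floor (phi / (2 * pi)); exists j.
(* Representative of [phi] in [[0, 2 pi)]. Its cosine is 1, so it is 0 by injectivity of [cos] on
   [[0, pi]], applied to [th] or to [2 pi - th]. *)
pose th := phi - j%:~R * (2 * pi).
have cth : cos th = cos 0.
  rewrite cos0 c1 -(per th j).1; congr cos; rewrite /th; ring.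
have th0 : 0 <= th by rewrite subr_ge0 -ler_pdivlMr // floor_le_tmp.
have thlt : th < 2 * pi.
  have := floorD1_gt (phi / (2 * pi)).
  by rewrite ltr_pdivrMr // rmorphD mulrDl mul1r -/j -ltrBlDl.
suff : th = 0 by move/eqP; rewrite subr_eq0 => /eqP.
have [thpi|pith] := lerP th pi.
  by apply: cos_inj cth; rewrite in_itv /= ?lexx ?th0 ?thpi ?pi_ge0.
have : 2 * pi - th = 0.
  apply: cos_inj.
  - by rewrite in_itv /=; lra.
  - by rewrite in_itv /= lexx pi_ge0.
  by rewrite -cth -[RHS]cosN -[RHS]cosD2pi; congr cos; ring.
by move/eqP; rewrite subr_eq0 gt_eqF.
Qed.

(** The integral of [g] would bound [d ln (T / t0)] for every [T > t0]. *)
Lemma ge_inv_not_integrable (g : R -> R) (d t0 : R) : 0 < d -> 0 < t0 ->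
  (forall t, 0 <= g t) -> (forall t, t0 <= t -> d / t <= g t) ->
  ~ mu.-integrable setT (fun t => (g t)%:E).
Proof.
move=> d0 t00 g0 gd ig.
have mg := measurable_int _ ig.
have fin : (\int[mu]_t (g t)%:E \is a fin_num)%E by exact: integrable_fin_num.
have bnd T : t0 < T -> d * ln T - d * ln t0 <= \int[mu]_t g t.
  move=> tT.
  have ct : {within [set` `[t0, T]%R], continuous (fun t : R => d / t)}.
    apply: continuous_in_subspaceT => t; rewrite inE /= in_itv /= => /andP[tt _].
    apply: cvgM; first exact: cvg_cst.
    by apply: cvgV; [rewrite gt_eqF // (lt_le_trans t00)|exact: cvg_id].
  have FTC : (\int[mu]_(t in [set` `[t0, T]%R]) (d / t)%:E)%E = (d * ln T - d * ln t0)%:E.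
    have dl (t : R) : 0 < t -> is_derive t (1 : R) (fun t => d * ln t) (d / t).
      move=> tp; have h := is_deriveM (is_derive_cst (d : R) t (1 : R)) (is_derive1_ln tp).
      by apply: (is_derive_ext h) => //; rewrite /GRing.scale /= mulr0 addr0.
    have cl (t : R) : 0 < t -> {for t, continuous (fun t => d * ln t)}.
      move=> /dl h; apply/differentiable_continuous/derivable1_diffP; exact: ex_derive.
    rewrite (@continuous_FTC2 _ (fun t => d / t) (fun t => d * ln t)) //.
    - split.
      + move=> t; rewrite in_itv /= => /andP[tt _]; have h := dl t (lt_trans t00 tt).
        exact: ex_derive.
      + by apply: cvg_at_right_filter; exact: cl.
      + by apply: cvg_at_left_filter; apply: cl; rewrite (lt_trans t00).
    - move=> t; rewrite in_itv /= => /andP[tt _]; have h := dl t (lt_trans t00 tt).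
      by rewrite derive1E; exact: derive_val.
  rewrite -lee_fin -FTC fineK //.
  apply: (@le_trans _ _ (\int[mu]_(t in [set` `[t0, T]%R]) (g t)%:E)%E).
    apply: ge0_le_integral => //=.
    - by move=> t; rewrite in_itv /= => /andP[tt _];
        rewrite lee_fin divr_ge0 // ltW // (lt_le_trans t00).
    - apply/measurable_EFinP; exact: subspace_continuous_measurable_fun (measurable_itv _) ct.
    - exact: measurable_funS mg.
    - by move=> t; rewrite in_itv /= => /andP[tt _]; rewrite lee_fin gd.
  apply: (@ge0_subset_integral _ _ _ mu _ setT) => //.
  by move=> t _; rewrite lee_fin.
pose I := \int[mu]_t g t.
(* Chosen so that [d ln T - d ln t0] is at least [I + d], hence exceeds [I]. *)
pose T := t0 + expR ((I + d * ln t0) / d + 1).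
have := bnd T; rewrite ltrDl expR_gt0 => /(_ isT); apply/negP; rewrite -ltNge -/I.
have : (I + d * ln t0) / d + 1 <= ln T.
  by rewrite -[X in X <= _]expRK ler_ln ?posrE ?expR_gt0 ?addr_gt0 ?expR_gt0 // lerDr ltW.
move=> /(ler_wpM2l (ltW d0)); rewrite mulrDr mulr1 mulrCA mulfV ?gt_eqF // mulr1.
by move: d0; lra.
Qed.

Lemma normc_le_ReIm (z : C) : ComplexField.Normc.normc z <= `|Re z| + `|Im z|.
Proof.
have h := ler_normD (Re z)%:C ('i%C * (Im z)%:C).
rewrite -complexE normrM !normr_complexE /= !expr0n /= in h.
by rewrite !addr0 add0r expr1n sqrtr1 mul1r !sqrtr_sqr -rmorphD lecR in h.
Qed.

(** If the degrees differed by exactly one, [t P(t) / Q(t)] would tend to some [c != 0], so the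
    modulus of [P / Q] would be at least [|c| / (2 t)] for large [t]. This supplies the degree
    missing in the case [m = 1] of the first formula. *)
Lemma cintegrable_size (P Q : {poly C}) n : (size P <= n.+1)%N -> size Q = n.+2 ->
  cintegrable (fun t => P.[t%:C] / Q.[t%:C]) -> (size P <= n)%N.
Proof.
move=> sP sQ [iRe iIm]; rewrite leqNgt; apply/negP => nP.
have {nP}sP : size P = n.+1 by apply/eqP; rewrite eqn_leq sP.
have Qn : Q`_n.+1 != 0.
  have : lead_coef Q != 0 by rewrite lead_coef_eq0 -size_poly_eq0 sQ.
  by rewrite /lead_coef sQ.
have Pn : P`_n != 0.
  have : lead_coef P != 0 by rewrite lead_coef_eq0 -size_poly_eq0 sP.
  by rewrite /lead_coef sP.
pose f t := P.[t%:C] / Q.[t%:C]; pose c := P`_n / Q`_n.+1.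
have c0 : 0 < ComplexField.Normc.normc c / 2.
  by rewrite divr_gt0 // -ltcR -normr_complexE normr_gt0 mulf_neq0 ?invr_eq0.
have n0 : \forall t \near +oo, (t : R) != 0.
  by near=> t; rewrite gt_eqF //; near: t; exact: nbhs_pinfty_gt.
have lim : ((P * 'X).[t%:C] / Q.[t%:C] : C^o) @[t --> +oo] --> (c : C^o).
  have -> : c = (P * 'X)`_n.+1 / Q`_n.+1 by rewrite coefMX.
  apply: (@cvg_ratio_infty R +oo _ id) => //; first exact: cvg_invr_pinfty.
  - by rewrite size_mulX ?sP // -size_poly_eq0 sP.
  - by rewrite sQ.
have /cvgrPdist_lt /(_ (ComplexField.Normc.normc c / 2)%:C) := lim.
rewrite ltcR => /(_ c0) [M [_ hM]].
pose t0 := Num.max M 0 + 1.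
have t00 : 0 < t0 by rewrite ltr_wpDl // le_max lexx orbT.
(* Integrable together with the two parts of [f], and an upper bound for the modulus of [f]. *)
pose g t := `|Re (f t)| + `|Im (f t)|.
apply: (@ge_inv_not_integrable g (ComplexField.Normc.normc c / 2) t0) => //.
- by move=> t; rewrite addr_ge0.
- move=> t t0t; have tM : M < t by rewrite (lt_le_trans _ t0t) // ltr_pwDr // le_max lexx.
  have tp : 0 < t := lt_le_trans t00 t0t.
  apply: le_trans (normc_le_ReIm _); rewrite ler_pdivrMr //.
  have := hM t tM; rewrite hornerMX [_ * t%:C]mulrC -mulrA -/(f t).
  have := ler_normD (c - t%:C * f t) (t%:C * f t); rewrite subrK.
  rewrite !normr_complexE -rmorphD lecR ltcR (ComplexField.Normc.normcM t%:C).
  have -> : ComplexField.Normc.normc t%:C = t.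
    by rewrite /= expr0n /= addr0 sqrtr_sqr gtr0_norm.
  by lra.
- have := integrableD measurableT (integrable_abse iRe) (integrable_abse iIm).
  exact.
Unshelve. all: by end_near. Qed.

(** Serves to rescale summands by [m] and to take their real parts, at finite and infinite nodes
    alike. *)
Lemma summand_comp (T : topologicalType) (S : topologicalType) (f : R -> T) (h : T -> S)
    (g : R -> S) p v : continuous h -> (forall t, g t = h (f t)) ->
  summand f p v -> summand g p (h v).
Proof.
move=> ch gE; case: p => [t /= ->|[l1 l2]]; first by rewrite gE.
by split; under eq_fun do rewrite gE; [exact: (cvg_comp _ h l1 (ch _))|
  exact: (cvg_comp _ h l2 (ch _))].
Qed.
End Integrability.

(** * The poles of a rational fraction *)

Section Poles.
Variable R : realType.
Local Notation C := R[i].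
Local Notation Re := (@complex.Re R).
Local Notation Im := (@complex.Im R).

Lemma Im_conjc (w : C) : Im w^* = - Im w.
Proof. by case: w. Qed.

(** Reflects a nonreal point into the upper half-plane; the poles of the fraction become the [z_k],
    with multiplicities [n_k]. *)
Definition upper (w : C) : C := if 0 < Im w then w else w^*.

Lemma Im_upper_gt0 w : Im w != 0 -> 0 < Im (upper w).
Proof.
rewrite /upper neq_lt => /orP[w0|w0]; last by rewrite w0.
by rewrite ifN ?Im_conjc ?oppr_gt0 // -leNgt ltW.
Qed.

Lemma upper_eq (w y : C) : 0 < Im w -> (upper y == w) = (y == w) || (y == w^*).
Proof.
move=> w0; rewrite /upper; case: ifPn => [y0|].
  have [//|_ /=] := eqVneq y w; apply/esym/eqP => yw.
  by move: y0; rewrite yw Im_conjc oppr_gt0 ltNge ltW.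
rewrite -leNgt => y0; rewrite (can2_eq (@conjcK R) (@conjcK R)).
by have [yw|//] := eqVneq y w; move: y0; rewrite yw leNgt w0.
Qed.

(** A point and its reflection form the same conjugate pair, so the product can be written on the
    original poles. *)
Lemma prod_upper (T : comNzRingType) (h : C -> T) s :
  \prod_(w <- map upper s) h w * \prod_(w <- map conjc (map upper s)) h w =
  \prod_(w <- s) (h w * h w^*).
Proof.
rewrite -map_comp !big_map -big_split /=; apply: eq_bigr => w _.
by rewrite /upper; case: ifP => //; rewrite conjcK mulrC.
Qed.

Lemma prod_nseq_flatten (T : comNzRingType) (h : C -> T) (u : seq C) m :
  \prod_(w <- flatten (nseq m u)) h w = (\prod_(w <- u) h w) ^+ m.
Proof.
by rewrite big_flatten big_nseq iter_mulr_1.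
Qed.

Lemma map_flatten_nseq (T S : Type) (h : T -> S) (u : seq T) m :
  map h (flatten (nseq m u)) = flatten (nseq m (map h u)).
Proof. by rewrite map_flatten map_nseq. Qed.

(** Multiplicities are compared: the preimages under [upper] of a point [w] of the upper half-plane
    are [w] and its conjugate, whose pole multiplicities add up to [n_k] when [w = z_k]. Any other
    [w] occurs in neither list. *)
Lemma star_poles_perm (P Q : {poly C}) nu (z : 'I_nu -> C) nk s :
  rf_den P Q != 0 -> star_poles P Q z nk ->
  (forall w, count_mem w s = pole_mult P Q w) ->
  {in s, forall w, Im w != 0} ->
  perm_eq (map upper s) (flatten [seq nseq (nk k) (z k) | k <- index_enum 'I_nu]).
Proof.
move=> Q0 [injz zP nkE] sE s0; apply/allP => w /= _; apply/eqP.
have cu : 0 < Im w -> count_mem w (map upper s) = (pole_mult P Q w + pole_mult P Q w^*)%N.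
  move=> w0; rewrite count_map (@eq_count _ _ (predU (pred1 w) (pred1 w^*))); last first.
    by move=> y; rewrite /= upper_eq.
  rewrite -!sE -count_predUI [X in (_ + X)%N](_ : _ = 0%N) ?addn0 //.
  apply/eqP; rewrite -leqn0 leqNgt -has_count; apply/hasPn => y _ /=.
  apply/negP => /andP[/eqP-> /eqP ww].
  by move: (w0); rewrite {1}ww Im_conjc oppr_gt0 ltNge ltW.
rewrite count_flatten -map_comp sumnE big_map.
under eq_bigr do rewrite /= count_nseq /=.
have [[k zk]|nz] := pselect (exists k, z k = w).
  rewrite (bigD1 k) //= zk eqxx mul1n big1 ?addn0 => [|j jk]; last first.
    by rewrite -zk (inj_eq injz) (negbTE jk).
  by rewrite cu ?nkE ?zk //; have [] := (zP w).1 (ex_intro _ k zk).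
rewrite big1 => [|k _]; last by case: eqP => // zk; case: nz; exists k.
have [w0|w0] := ltrP 0 (Im w); last first.
  apply/eqP; rewrite -leqn0 leqNgt -has_count has_pred1; apply/mapP => -[y ys wy].
  by move: w0; rewrite wy leNgt Im_upper_gt0 // s0.
rewrite cu // /pole_mult !mupNroot //; apply/negP => h; apply: nz; apply/zP; split => //;
  [right|left]; exact: h.
Qed.

Lemma rf_den_decomp (P Q : {poly C}) s : rf_den P Q != 0 ->
  (forall w, count_mem w s = pole_mult P Q w) ->
  rf_den P Q = lead_coef (rf_den P Q) *: \prod_(w <- s) ('X - w%:P).
Proof.
move=> Q0 sE; have [r rE] := closed_field_poly_normal (rf_den P Q).
rewrite {1}rE; congr (_ *: _); apply: perm_big; apply/allP => w _ /=; apply/eqP.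
rewrite sE /pole_mult rE -mul_polyC mupMr ?mu_prod_XsubC //.
by rewrite rootC lead_coef_eq0.
Qed.
End Poles.

(** * The polynomials and weights attached to the poles of a given fraction *)

Section PoleSequence.
Variable R : realType.
Local Notation C := R[i].
Local Notation Re := (@complex.Re R).
Local Notation Im := (@complex.Im R).
Local Notation mu := (@lebesgue_measure R).

Lemma size_exp_le (F : idomainType) (p : {poly F}) m k : (size p <= k.+1)%N ->
  (size (p ^+ m) <= (k * m).+1)%N.
Proof.
move=> sp; apply: (leq_trans (size_poly_exp_leq _ _)); rewrite ltnS leq_mul2r.
by apply/orP; right; case: size sp.
Qed.

Lemma conj_hornerR (p : {poly C}) (t : R) :
  (p.[t%:C])^* = (map_poly conjc p).[t%:C].
Proof. by rewrite -[in RHS](conjc_real t) horner_map. Qed.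

Section Setup.
Variables (P Q : {poly C}) (n : nat).
Hypothesis proper : (size P < size Q)%N.
Hypothesis deg_n : rf_degree P Q n.
Hypothesis no_real_pole : forall x : R, ~ is_pole P Q x%:C.

Lemma rf_den_neq0 : rf_den P Q != 0.
Proof.
have Q0 : Q != 0 by rewrite -size_poly_gt0 (leq_ltn_trans _ proper).
rewrite /rf_den; have := divpK (dvdp_gcdr P Q).
by apply: contra_eq_neq => ->; rewrite mul0r eq_sym.
Qed.

Lemma size_rf_num_den : (size (rf_num P Q) < size (rf_den P Q))%N.
Proof.
have Q0 : Q != 0 by rewrite -size_poly_gt0 (leq_ltn_trans _ proper).
have g0 : gcdp P Q != 0 by rewrite gcdp_eq0 negb_and Q0 orbT.
rewrite !size_divp // ltn_sub2r //.
(* The truncated subtraction keeps the inequality strict, since what is subtracted is less than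
   [size Q]. *)
by apply: leq_trans (dvdp_leq Q0 (dvdp_gcdr P Q)); rewrite prednK ?size_poly_gt0.
Qed.

Lemma poles_seq : exists s : seq C, [/\ size s = n,
  forall w, count_mem w s = pole_mult P Q w, {in s, forall w, Im w != 0},
  rf_den P Q = lead_coef (rf_den P Q) *: \prod_(w <- s) ('X - w%:P) &
  (size (rf_num P Q) <= n)%N].
Proof.
have [s [sE sn]] := deg_n; exists s.
have QE := rf_den_decomp rf_den_neq0 sE.
split=> // [w ws|].
  apply: contraPneq (@no_real_pole (Re w)) => w0; apply.
  have -> : (Re w)%:C = w by apply: complex_ext.
  rewrite /is_pole; apply: contraTT ws => /mupNroot wr.
  by rewrite -has_pred1 has_count sE /pole_mult wr.
have := size_rf_num_den.
rewrite [in X in (_ < X)%N]QE size_scale ?lead_coef_eq0 ?rf_den_neq0 //.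
by rewrite size_prod_XsubC sn ltnS.
Qed.

End Setup.

Section Star.
Variables (P Q : {poly C}) (nu : nat) (z : 'I_nu -> C) (nk : 'I_nu -> nat).
Variables (s : seq C) (m : nat).
Hypothesis Q0 : rf_den P Q != 0.
Hypothesis z_poles : star_poles P Q z nk.
Hypothesis sE : forall w, count_mem w s = pole_mult P Q w.
Hypothesis s0 : {in s, forall w, Im w != 0}.
Let U := flatten (nseq m (map (@upper R) s)).

Lemma Im_poles_gt0 : {in U, forall w, 0 < Im w}.
Proof.
move=> w /flattenP[_ /nseqP[-> _] /mapP[y /s0 y0 ->]]; exact: Im_upper_gt0.
Qed.

Lemma size_poles : size U = (m * size s)%N.
Proof. by rewrite size_flatten /shape map_nseq sumn_nseq size_map mulnC. Qed.

Lemma Bstar_poly t : Bstar z nk t ^+ m = (upoly U).[t%:C] / (lpoly U).[t%:C].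
Proof.
rewrite /upoly /lpoly map_flatten_nseq !prod_nseq_flatten !horner_exp -expr_div_n.
congr (_ ^+ _); rewrite !horner_prod_XsubC [X in _ / X]big_map -prodf_div.
rewrite (perm_big _ (star_poles_perm Q0 z_poles sE s0)) big_flatten big_map /=.
by apply: eq_bigr => k _; rewrite big_nseq iter_mulr_1.
Qed.

Lemma poisson_mustar t : poisson U t = m%:R * mustar z nk t.
Proof.
rewrite /poisson big_flatten big_nseq iter_addr_0 mulr_natl; congr (_ *+ _).
rewrite (perm_big _ (star_poles_perm Q0 z_poles sE s0)) big_flatten big_map /=.
by apply: eq_bigr => k _; rewrite big_nseq iter_addr_0 -mulrA mulr_natl.
Qed.

(** The right-hand side is, up to a constant, the [m]-th power of the squared modulus of the
    denominator of the fraction, and both integrands can be written over it. *)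
Lemma ulpoly_prod t : (upoly U).[t%:C] * (lpoly U).[t%:C] =
  (\prod_(w <- s) ((t%:C - w) * (t%:C - w^*))) ^+ m.
Proof.
rewrite /upoly /lpoly map_flatten_nseq !prod_nseq_flatten !horner_exp -exprMn.
by rewrite !horner_prod_XsubC prod_upper.
Qed.

End Star.
End PoleSequence.

(** * The powers of the fraction and of its modulus as instances of the quadrature *)

Theorem theorem2p2 (R : realType) (P Q : {poly R[i]}) (n : nat)
    (proper : (size P < size Q)%N)
    (deg_n : rf_degree P Q n)
    (no_real_pole : forall x : R, ~ is_pole P Q x%:C)
    (nu : nat) (z : 'I_nu -> R[i]) (nk : 'I_nu -> nat)
    (z_poles : star_poles P Q z nk)
    (m : nat) (m_gt0 : (0 < m)%N) (phi : R)
    (x : 'I_(m * n) -> one_point_compactification R)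
    (x_notches : notches z nk m phi x) :
  let f := fun t : R => rf_eval P Q t%:C in
  let absf := fun t : R => ComplexField.Normc.normc (f t) in
  [/\ (cintegrable (fun t => f t ^+ m) ->
        exists s : 'I_(m * n) -> R[i],
          (forall k, @summand R (R[i]^o : topologicalType)
             (fun t => f t ^+ m / (mustar z nk t)%:C) (x k) (s k)) /\
          cintegral (fun t => f t ^+ m) =
            (pi / m%:R)%:C * \sum_(k < m * n) s k),
      ((@lebesgue_measure R).-integrable setT
           (fun t => (absf t ^+ (2 * m))%:E) ->
        exists s : 'I_(m * n) -> R,
          (forall k, summand
             (fun t => absf t ^+ (2 * m) / mustar z nk t) (x k) (s k)) /\
          \int[@lebesgue_measure R]_t (absf t ^+ (2 * m)) =
            (pi / m%:R) * \sum_(k < m * n) s k)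
    & ((exists k, x k = None) <-> (exists j : int, phi = j%:~R * (2 * pi)))].
Proof.
move=> f absf; have [injx xE] := x_notches.
have Q0 := rf_den_neq0 proper.
have [s [sn sE s0 QE sP]] := poles_seq proper deg_n no_real_pole.
set p := rf_num P Q in sP f absf *; set q := rf_den P Q in Q0 QE *.
pose c := lead_coef q; have c0 : c != 0 by rewrite lead_coef_eq0.
pose U := flatten (nseq m (map (@upper R) s)).
have U0 := @Im_poles_gt0 R s m s0; rewrite -/U in U0.
have sU : size U = (m * n)%N by rewrite size_poles sn.
have xU v : (exists k, x k = v) <-> (if v is Some t then
    (upoly U).[t%:C] / (lpoly U).[t%:C] else 1) = expi phi.
  move: (xE v); case: v => [t|] /=; last by rewrite expr1n.
  by rewrite (Bstar_poly m Q0 z_poles sE s0).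
(* Since [poisson] is [m] times [mustar], the summands gain a factor [m], and the constant [pi]
   becomes [pi / m]. *)
have quad (G : {poly R[i]}) (F : R -> R[i]) : (size G <= (m * n + m * n).-1)%N ->
    F =1 (fun t => G.[t%:C] / ((upoly U).[t%:C] * (lpoly U).[t%:C])) ->
    exists v : 'I_(m * n) -> R[i],
    (forall k, @summand R (R[i]^o : topologicalType)
       (fun t => F t / (mustar z nk t)%:C) (x k) (v k)) /\
    pvint F ((pi / m%:R)%:C * \sum_k v k).
  move=> sG FE.
  have [v [vs vint]] := notch_quadrature U0 sU sG injx xU.
  exists (fun k => m%:R * v k); split=> [k|].
    apply: (@summand_comp R _ _ _ ( *%R (m%:R : R[i]^o)) _ _ _ _ _ (vs k)) => [y|t].
      exact: mulrl_continuous.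
    rewrite (poisson_mustar m Q0 z_poles sE s0) rmorphM rmorph_nat /=.
    rewrite [X in _ = _ * (_ * X)]invfM.
    transitivity (m%:R / m%:R * (F t / (mustar z nk t)%:C)); last by rewrite FE; ring.
    by rewrite mulfV ?mul1r // pnatr_eq0 -lt0n.
  apply: (pvint_ext (v := _)) => [|t]; last exact/esym/FE.
  have -> // : (pi / m%:R)%:C * (\sum_k m%:R * v k) = pi%:C * \sum_k v k.
  by rewrite -mulr_sumr rmorphM fmorphV rmorph_nat mulrA divfK // pnatr_eq0 -lt0n.
have fE t : f t = p.[t%:C] / (c * \prod_(w <- s) (t%:C - w)).
  by rewrite /f /rf_eval -/p -/q QE hornerZ horner_prod_XsubC.
(* Multiplying numerator and denominator of the fraction by [qc] brings its powers over the common
   denominator. *)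
pose qc := \prod_(w <- map conjc s) ('X - w%:P) : {poly R[i]}.
have sqc : size qc = n.+1 by rewrite size_prod_XsubC size_map sn.
have qcE t : qc.[t%:C] = \prod_(w <- s) (t%:C - w^*).
  by rewrite horner_prod_XsubC big_map.
have den0 t : \prod_(w <- s) (t%:C - w) != 0 by exact: prod_subC_neq0.
have denc0 t : \prod_(w <- s) (t%:C - w^*) != 0.
  by rewrite -(big_map (@conjc R) predT (fun w => t%:C - w)) prod_subC_neq0 // =>
    _ /mapP[w /s0 w0 ->]; rewrite Im_conjc oppr_eq0.
have sq : size q = n.+1.
  by rewrite QE size_scale ?lead_coef_eq0 // size_prod_XsubC sn.
split.
- move=> fint.
  have [||v [vs vint]] := quad (c ^- m *: (p * qc) ^+ m) (fun t => f t ^+ m).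
  + apply: leq_trans (size_scale_leq _ _) _.
    case: (n) sP sqc sq => [|n'] sP' sqc' sq'.
      have -> : p = 0 by apply/eqP; rewrite -size_poly_leq0.
      by rewrite mul0r expr0n gtn_eqF // size_poly0.
    (* The degree of the numerator is at most [m (2n - 1)], which is within [2mn - 2] only for
       [m >= 2]; for [m = 1] integrability lowers the degree of [p] by one. *)
    have [m1|m1] : m = 1%N \/ (1 < m)%N by case: (m) m_gt0 => [|[|?]]; [|left|right].
      rewrite m1 expr1 !mul1n.
      have sp : (size p <= n')%N.
        apply: cintegrable_size sP' sq' _; move: fint; rewrite m1.
        by under eq_fun do rewrite expr1.
      apply: leq_trans (size_polyMleq _ _) _.
      by rewrite sqc' !addnS addSn /= !ltnS leq_add2r.
    apply: leq_trans (@size_exp_le _ _ _ (n' + n').+1 _) _.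
      apply: leq_trans (size_polyMleq _ _) _.
      have -> : (n' + n').+2 = (n'.+1 + n'.+1)%N by rewrite addnS addSn.
      by rewrite sqc' addnS /= leq_add2r.
    by nia.
  + move=> t /=; rewrite ulpoly_prod hornerZ horner_exp hornerM qcE big_split /= fE.
    rewrite -[c ^- m]exprVn -exprMn -expr_div_n; congr (_ ^+ _); field.
    by rewrite c0 den0 denc0.
  exists v; split=> //; exact: cintegral_pv vint fint.
- move=> fint; pose pc := map_poly (@conjc R) p.
  have Fc t : (absf t ^+ (2 * m))%:C = (f t * (f t)^*%C) ^+ m.
    by rewrite -sqr_normc -exprM normr_complexE rmorphXn.
  (* Here [p * pc] has degree at most [2n - 2] when [n > 0], so the bound [2mn - 2] holds for every
     [m >= 1]. *)
  have [||v [vs vint]] := quad ((c * c^*%C) ^- m *: (p * pc) ^+ m)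
      (fun t => (absf t ^+ (2 * m))%:C).
  + apply: leq_trans (size_scale_leq _ _) _.
    have spc : size pc = size p by exact: size_map_poly.
    case: (n) sP => [|n'] sP'.
      have -> : p = 0 by apply/eqP; rewrite -size_poly_leq0.
      by rewrite mul0r expr0n gtn_eqF // size_poly0.
    apply: leq_trans (@size_exp_le _ _ _ (n' + n') _) _.
      apply: leq_trans (size_polyMleq _ _) _.
      by rewrite spc -subn1 leq_subLR (leq_trans (leq_add sP' sP')) // addSn addnS.
    by nia.
  + have conjE t : (\prod_(w <- s) (t%:C - w))^* = \prod_(w <- s) (t%:C - w^*).
      rewrite rmorph_prod; apply: eq_bigr => w _.
      by rewrite -[in RHS](conjc_real t); exact: rmorphB.
    have conj_div (a b d : R[i]) : (a / (b * d))^* = a^*%C / (b^*%C * d^*%C).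
      by rewrite rmorphM fmorphV rmorphM.
    have fcE t : (f t)^* = pc.[t%:C] / (c^*%C * \prod_(w <- s) (t%:C - w^*)).
      by rewrite fE conj_div conj_hornerR conjE.
    move=> t; rewrite Fc fcE fE ulpoly_prod hornerZ.
    have cc0 : c^* != 0 by rewrite conjc_eq0.
    move: (c^*) cc0 => d d0; rewrite horner_exp hornerM big_split /=.
    rewrite -[(c * d) ^- m]exprVn -exprMn -expr_div_n; congr (_ ^+ _); field.
    by rewrite c0 d0 den0 denc0.
  (* The integrand and the weights are real, so real parts carry the complex identity over to the
     real one, including limits at infinity. *)
  exists (fun k => complex.Re (v k)); split=> [k|].
    have Re_cont : continuous (@complex.Re R : R[i]^o -> R).
      move=> y; apply: (@cvg_complex_Re _ _ (nbhs (y : R[i]^o)) _ id); exact: cvg_id.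
    apply: (summand_comp Re_cont _ (vs k)) => t.
    by rewrite -fmorphV -rmorphM.
  have := Rintegral_pv_Re vint fint; rewrite /= => ->.
  have Re_real (a : R) (b : R[i]) : complex.Re (a%:C * b) = a * complex.Re b.
    by rewrite Re_mul /= mul0r subr0.
  rewrite Re_real; congr (_ * _).
  by elim/big_rec2: _ => // k a b _ <-; rewrite Re_add.
- by rewrite xU expi_eq1.
Qed.
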